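(* Assume $\|\nabla_{\mathbf{x}} f(\mathbf{x})\|\le L$ for all $\mathbf{x}\in\mathcal{X}$, that $\nu^2=\left\|\int\left(\nabla_{\mathbf{x}} f\,\nabla_{\mathbf{x}} f^T-C\right)^2\rho\,d\mathbf{x}\right\|>0$, and let $\mathbf{g}$ be an approximate gradient satisfying $\|\mathbf{g}(\mathbf{x})-\nabla_{\mathbf{x}} f(\mathbf{x})\|\le\sqrt{m}\,\gamma_h$ for all $\mathbf{x}\in\mathcal{X}$. Let $1\le n<m$ with $\lambda_{n+1}>0$. Choose $\varepsilon>0$ such that $$\varepsilon\;<\;\min\left(1,\;\frac{\lambda_n-\lambda_{n+1}}{5\lambda_1},\;\frac{\lambda_n-\lambda_{n+1}}{\lambda_n+\lambda_{n+1}}\right).$$ Let $\delta=\max\left(\frac{\nu^2}{\lambda_1\varepsilon},L^2\right)$ and $\kappa_{n+1}=\lambda_1/\lambda_{n+1}$, and choose $N$ so that both $$N=\Omega\left(\frac{\delta}{\lambda_1\varepsilon}\log(2m)\right)\quad\text{and}\quad N=\Omega\left(\frac{L^2\kappa_{n+1}^2}{\lambda_1\varepsilon^2}\log(m)\right).$$ Choose $h$ small enough so that $$\sqrt{m}\,\gamma_h\left(\sqrt{m}\,\gamma_h+2L\right)\;\le\;\frac{(1-\varepsilon)\lambda_n-(1+\varepsilon)\lambda_{n+1}}{5}.$$ Then $$\operatorname{dist}\big(\operatorname{ran}(\hat{U}_1),\operatorname{ran}(W_1)\big)\;\le\;\frac{4\sqrt{m}\,\gamma_h\left(\sqrt{m}\,\gamma_h+2L\right)}{(1-\varepsilon)\lambda_n-(1+\varepsilon)\lambda_{n+1}}+\frac{4\lambda_1\varepsilon}{\lambda_n-\lambda_{n+1}}$$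 with high probability. That is: for every $\beta>0$ there is a constant $c>0$ depending only on $\beta$ such that, whenever $N\ge c\,\frac{\delta}{\lambda_1\varepsilon}\log(2m)$ and $N\ge c\,\frac{L^2\kappa_{n+1}^2}{\lambda_1\varepsilon^2}\log(m)$, the last displayed inequality holds with probability at least $1-m^{-\beta}$.
   Context: Setting: $m>1$ is an integer and $\mathcal{X}\subseteq\mathbb{R}^m$ is centered at the origin and scaled so that all components of $\mathbf{x}\in\mathcal{X}$ have the same range. $\rho:\mathbb{R}^m\to\mathbb{R}_+$ is a bounded probability density (it integrates to 1), separable (a product of univariate functions of the coordinates), strictly positive on $\mathcal{X}$ and zero outside $\mathcal{X}$. The function $f:\mathcal{X}\to\mathbb{R}$ is differentiable and absolutely continuous, with gradient $\nabla_{\mathbf{x}} f$ written as a column vector. Define $C=\int (\nabla_{\mathbf{x}} f)(\nabla_{\mathbf{x}} f)^T\,\rho\,d\mathbf{x}=W\Lambda W^T$, a symmetric positive semidefinite $m\times m$ matrix, with $W$ orthogonal and $\Lambda=\mathrm{diag}(\lambda_1,\dots,\lambda_m)$, $\lambda_1\ge\cdots\ge\lambda_m\ge0$; $W_1$ consists of the first $n$ columns of $W$. The approximate gradient $\mathbf{g}:\mathcal{X}\to\mathbb{R}^m$ depends on a parameter $h>0$ (e.g. a finite difference step), and the error level $\gamma_h\ge0$ satisfies $\lim_{h\to0}\gamma_h=0$. Let $\mathbf{x}_1,\dots,\mathbf{x}_N$ be drawn independently from $\rho$ and let $\hat{G}=\frac1N\sum_{j=1}^N\mathbf{g}(\mathbf{x}_j)\mathbf{g}(\mathbf{x}_j)^T=\hat{U}\hat{\Theta}\hat{U}^T$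 be its eigendecomposition, with $\hat U$ orthogonal and eigenvalues in decreasing order; $\hat{U}_1$ consists of the first $n$ columns of $\hat{U}$. Norms are Euclidean norms of vectors and spectral (operator 2-) norms of matrices. For matrices $A,B$ with $n$ orthonormal columns, $\operatorname{dist}(\operatorname{ran}(A),\operatorname{ran}(B))=\|AA^T-BB^T\|$. The notation $a=\Omega(b)$ means $a\ge cb$ for some positive constant $c$; ''with high probability'' means with probability (over the samples) at least $1-m^{-\beta}$ for a prescribed $\beta>0$, the constant $c$ depending only on $\beta$. *)

(* Defs.v *)
From HB Require Import structures.
From mathcomp Require Import all_boot all_order all_algebra.
From mathcomp Require Import all_classical all_reals all_analysis.

Set Implicit Arguments.
Unset Strict Implicit.
Unset Printing Implicit Defensive.

Import Order.TTheory GRing.Theory Num.Theory.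
Import numFieldNormedType.Exports.

Local Open Scope classical_set_scope.
Local Open Scope ring_scope.

Definition measure_matrix_display : measure_display -> measure_display.
Proof. exact. Qed.

Section measurable_matrix.
Context {d} {T : measurableType d} {m n : nat}.

Definition matrix_cylinders : set (set 'M[T]_(m, n)) :=
  [set A | exists i j, exists2 B : set T,
     measurable B & A = (fun M : 'M[T]_(m, n) => M i j) @^-1` B].

(* For T = R this is the Borel sigma-algebra of R^(m x n). *)
HB.instance Definition _ :=
  @isMeasurable.Build (measure_matrix_display d) 'M[T]_(m, n)
    <<s matrix_cylinders >>
    (@sigma_algebra0 _ setT _) (@sigma_algebraC _ _)
    (@sigma_algebra_bigcup _ setT _).

Lemma measurable_mx_coord i j :
  measurable_fun setT (fun M : 'M[T]_(m, n) => M i j).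
Proof.
by move=> _ B mB; rewrite setTI; apply: sub_sigma_algebra; exists i, j, B.
Qed.

Lemma measurable_fun_mxP d' (S : measurableType d') (f : S -> 'M[T]_(m, n)) :
  (forall i j, measurable_fun setT (fun s => f s i j)) -> measurable_fun setT f.
Proof.
move=> mf; apply: (@measurability _ _ _ _ _ _ matrix_cylinders) => //.
by move=> _ [_ [i [j [B mB ->]]] <-]; exact: mf.
Qed.

End measurable_matrix.

Section lebesgue_step.
Context {R : realType} {m : nat}.

Definition vcons (p : R * 'cV[R]_m) : 'cV[R]_(1 + m) := col_mx p.1%:M p.2.

Lemma measurable_vcons : measurable_fun setT vcons.
Proof.
apply: measurable_fun_mxP => i j; rewrite /vcons; case: (split_ordP i) => k ->.
  under [X in measurable_fun _ X]eq_fun do rewrite col_mxEu !ord1 mxE eqxx mulr1n.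
  exact: measurable_fst.
under [X in measurable_fun _ X]eq_fun do rewrite col_mxEd.
exact: (measurableT_comp (measurable_mx_coord k j) measurable_snd).
Qed.

Variable mu : {sigma_finite_measure set 'cV[R]_m -> \bar R}.

Definition lebesgue_step : set 'cV[R]_(1 + m) -> \bar R :=
  pushforward (lebesgue_measure \x mu)%E vcons.

HB.instance Definition _ := Measure.copy lebesgue_step
  (measure_function_pushforward__canonical__measure_function_Measure
    (lebesgue_measure \x mu)%E measurable_vcons).

Lemma lebesgue_step_sigma_finite : sigma_finite setT lebesgue_step.
Proof.
have /sigma_finiteP[F [TF ndF Foo]] := sigma_finiteT (@lebesgue_measure R).
have /sigma_finiteP[G [TG ndG Goo]] := sigma_finiteT mu.
pose head (x : 'cV[R]_(1 + m)) : R := x 0 0.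
pose tail (x : 'cV[R]_(1 + m)) : 'cV[R]_m := dsubmx x.
have mtail : measurable_fun setT tail.
  apply: measurable_fun_mxP => i j; rewrite /tail.
  under [X in measurable_fun _ X]eq_fun do rewrite mxE.
  exact: measurable_mx_coord.
have headK p : head (vcons p) = p.1.
  rewrite /head /vcons; have <- : lshift m 0 = 0 :> 'I_(1 + m) by exact: val_inj.
  by rewrite col_mxEu mxE eqxx mulr1n.
have tailK p : tail (vcons p) = p.2 by rewrite /tail col_mxKd.
exists (fun k => head @^-1` F k `&` tail @^-1` G k).
  apply/seteqP; split=> // x _.
  have [i _ Fi] : (\bigcup_i F i) (head x) by rewrite -TF.
  have [j _ Gj] : (\bigcup_i G i) (tail x) by rewrite -TG.
  exists (maxn i j) => //; split => /=.
    by move: (head x) Fi; exact/subsetPset/ndF/leq_maxl.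
  by move: (tail x) Gj; exact/subsetPset/ndG/leq_maxr.
move=> k; have [mF Foo'] := Foo k; have [mG Goo'] := Goo k; split.
  apply: measurableI; rewrite -[X in measurable X]setTI.
    exact: measurable_mx_coord.
  exact: mtail.
rewrite /lebesgue_step /pushforward (_ : _ @^-1` _ = F k `*` G k); last first.
  by apply/seteqP; split=> p /=; rewrite headK tailK.
by rewrite product_measure1E// lte_mul_pinfty// ge0_fin_numE.
Qed.

HB.instance Definition _ := Measure_isSigmaFinite.Build _ _ _ lebesgue_step
  lebesgue_step_sigma_finite.

End lebesgue_step.

Fixpoint lebesgue_vec {R : realType} (m : nat) :
    {sigma_finite_measure set 'cV[R]_m -> \bar R} :=
  match m with
  | 0 => (\d_(0 : 'cV[R]_0) : {sigma_finite_measure set 'cV[R]_0 -> \bar R})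
  | k.+1 => (lebesgue_step (lebesgue_vec k)
             : {sigma_finite_measure set 'cV[R]_(1 + k) -> \bar R})
  end.

(* This identity on boxes characterizes lebesgue_vec m as the m-dimensional
   Lebesgue measure. *)
Lemma lebesgue_vec_box (R : realType) m (A : 'I_m -> set R) :
  (forall i, measurable (A i)) ->
  lebesgue_vec m [set x : 'cV[R]_m | forall i, A i (x i 0)] =
  (\prod_(i < m) lebesgue_measure (A i))%E.
Proof.
elim: m A => [|m IH] A mA.
  rewrite big_ord0 /= diracE mem_set//= => -[].
  by case.
rewrite big_ord_recl /= /lebesgue_step /pushforward.
rewrite -(IH (fun i => A (lift ord0 i))) //.
have mB : measurable [set x : 'cV[R]_m | forall i, A (lift ord0 i) (x i 0)].
  rewrite (_ : [set x | _] = \big[setI/setT]_(i < m)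
      ((fun M : 'cV[R]_m => M i 0) @^-1` A (lift ord0 i))).
    apply: bigsetI_measurable => i _.
    by rewrite -[X in measurable X]setTI; exact: measurable_mx_coord.
  rewrite -bigcap_seq; apply/seteqP; split=> x /= h i => [_|]; first exact: h.
  by apply: h; rewrite /= mem_index_enum.
apply: etrans (product_measure1E lebesgue_measure (lebesgue_vec m) (mA ord0) mB).
have E0 : (@ord0 m : 'I_(1 + m)) = lshift m ord0 by exact: val_inj.
have ES (i : 'I_m) : (lift (@ord0 m) i : 'I_(1 + m)) = rshift 1 i by exact: val_inj.
have vcons0 (p : R * 'cV[R]_m) : vcons p (@ord0 m) 0 = p.1.
  by rewrite E0 /vcons col_mxEu mxE mulr1n.
have vconsS (p : R * 'cV[R]_m) i : vcons p (lift (@ord0 m) i) 0 = p.2 i 0.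
  by rewrite ES /vcons col_mxEd.
congr (product_measure1 _ _ _); apply/seteqP; split => p /=.
  move=> h; split; first by have := h ord0; rewrite vcons0.
  by move=> i; have := h (lift ord0 i); rewrite vconsS.
move=> [ha hv] i; case: (unliftP ord0 i) => [j ->|->].
  by have := hv j; rewrite -vconsS.
by move: ha; rewrite -vcons0.
Qed.

Section linear_algebra.
Context {R : realType}.

(* The library norm on matrices is the sup norm of the entries. *)
Definition vnorm m (v : 'cV[R]_m) : R := Num.sqrt (\sum_i v i 0 ^+ 2).

Definition specnorm m n (A : 'M[R]_(m, n)) : R :=
  sup [set vnorm (A *m v) | v in [set v : 'cV[R]_n | vnorm v <= 1]].

(* Eigenvalues are numbered from 1, as in lambda_1 >= ... >= lambda_m; the
   values of lam outside 1, ..., m are irrelevant. *)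
Definition eigen_decomposition m (A W : 'M[R]_m) (lam : nat -> R) : Prop :=
  [/\ W^T *m W = 1%:M,
      A = W *m diag_mx (\row_(i < m) lam i.+1) *m W^T &
      forall j k : nat, (1 <= j)%N -> (j <= k)%N -> (k <= m)%N ->
        lam k <= lam j].

Definition first_cols m n (nm : (n <= m)%N) (W : 'M[R]_m) : 'M[R]_(m, n) :=
  colsub (widen_ord nm) W.

(* A *m A^T is the orthogonal projector onto ran A when the columns of A are
   orthonormal. *)
Definition range_dist m n (A B : 'M[R]_(m, n)) : R :=
  specnorm (A *m A^T - B *m B^T).

End linear_algebra.

Section functions.
Context {R : realType} {m : nat}.
Implicit Types (X : set 'cV[R]_m) (f rho : 'cV[R]_m -> R).

(* A function on X is represented by a total function whose values outside X
   play no role: f is differentiable at x relative to X, with gradient v. *)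
Definition is_gradient X f (x v : 'cV[R]_m) : Prop :=
  (f y - f x - (v^T *m (y - x)) 0 0) / vnorm (y - x)
    @[y --> within X x^'] --> (0 : R).

Definition abs_continuous_itv (a b : R) (phi : R -> R) : Prop :=
  forall e : R, 0 < e -> exists2 d : R, 0 < d &
    forall s : seq (R * R),
      (forall p, p \in s -> a <= p.1 /\ p.1 <= p.2 /\ p.2 <= b) ->
      pairwise (fun p q : R * R => p.2 <= q.1) s ->
      \sum_(p <- s) (p.2 - p.1) < d ->
      \sum_(p <- s) `|phi p.2 - phi p.1| < e.

(* Absolute continuity in several variables is read along line segments. *)
Definition abs_continuous_on X f : Prop :=
  forall x y : 'cV[R]_m,
    (forall t : R, 0 <= t <= 1 -> X (x + t *: (y - x))) ->
    abs_continuous_itv 0 1 (fun t => f (x + t *: (y - x))).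

(* Every coordinate ranges over X with the same bounds -r and r, which are
   infinite for instance when X is the whole space. *)
Definition centered_scaled X : Prop :=
  exists r : \bar R, forall i : 'I_m,
    ereal_inf [set (x i 0)%:E | x in X] = (- r)%E /\
    ereal_sup [set (x i 0)%:E | x in X] = r.

Record separable_density X rho : Prop := SeparableDensity {
  density_measurable : measurable_fun setT rho ;
  density_integral1 : (\int[lebesgue_vec m]_x (rho x)%:E = 1)%E ;
  density_bounded : exists M : R, forall x, rho x <= M ;
  density_separable : exists rho1 : 'I_m -> R -> R,
    forall x, rho x = \prod_(i < m) rho1 i (x i 0) ;
  density_gt0 : forall x, X x -> 0 < rho x ;
  density_eq0 : forall x, ~ X x -> rho x = 0 }.

Definition mx_integral X rho (F : 'cV[R]_m -> 'M[R]_m) : 'M[R]_m :=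
  \matrix_(i, j) \int[lebesgue_vec m]_(x in X) (F x i j * rho x).

Definition mx_integrable X rho (F : 'cV[R]_m -> 'M[R]_m) : Prop :=
  forall i j, (lebesgue_vec m).-integrable X (fun x => (F x i j * rho x)%:E).

Definition outer_sq (g : 'cV[R]_m -> 'cV[R]_m) (x : 'cV[R]_m) : 'M[R]_m :=
  g x *m (g x)^T.

Definition sample_mean_outer N (g : 'cV[R]_m -> 'cV[R]_m)
    (x : 'I_N -> 'cV[R]_m) : 'M[R]_m :=
  N%:R^-1 *: \sum_(j < N) outer_sq g (x j).

End functions.

Section sampling.
Context {R : realType} {d : measure_display} {Omega : measurableType d}.
Variable P : probability Omega R.

Record iid_sample m N (rho : 'cV[R]_m -> R) (x : 'I_N -> Omega -> 'cV[R]_m) :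
    Prop := IidSample {
  sample_measurable : forall j, measurable_fun setT (x j) ;
  sample_density : forall j (B : set 'cV[R]_m), measurable B ->
    (P (x j @^-1` B) = \int[lebesgue_vec m]_(y in B) (rho y)%:E)%E ;
  sample_independent : forall (J : {set 'I_N}) (B : 'I_N -> set 'cV[R]_m),
    (forall j, measurable (B j)) ->
    (P (\bigcap_(j in [set` J]) (x j @^-1` B j)) =
     \prod_(j in J) P (x j @^-1` B j))%E }.

(* For a measurable event Q this says that P Q >= p; in general it says so for
   the inner probability of Q. *)
Definition with_probability_at_least (p : R) (Q : Omega -> Prop) : Prop :=
  exists E : set Omega,
    [/\ measurable E, (p%:E <= P E)%E & forall w, E w -> Q w].

End sampling.

(* Main.v *)
(** The sample mean [C^] of the outer squares of the exact gradients is compared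
    with [C] by moments of the trace, without matrix exponentials.  Let [S] be
    [N (C^ - C)].  Exchanging one observation for an independent copy and the
    inequality [2 tr (A-B)(A^(2q+1)-B^(2q+1)) <= (2q+1) tr (A-B)^2 (A^(2q)+B^(2q))]
    give [E tr S^(2q+2) <= (a^2 + 4 a N lambda_1) E tr S^(2q)] with
    [a = (2q+1) L^2], because the summands [Y] satisfy [Y^2 <= L^2 Y].  Iterating
    [p ~ (1 + beta) ln m] times, Markov's inequality yields
    [|C^ - C| <= lambda_1 eps] with probability at least [1 - m^(-beta)]; only the
    second lower bound on [N] is needed for this, since [kappa >= 1].  The error
    in the gradients adds at most [sqrt m gamma (sqrt m gamma + 2 L)], and the
    eigenspaces are compared by Weyl's inequality and a Sylvester equation. *)
Require Import Defs.
From HB Require Import structures.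
From mathcomp Require Import all_boot all_order all_algebra.
From mathcomp Require Import all_classical all_reals all_analysis.
From mathcomp Require Import measurable_realfun.
From mathcomp Require Import ring lra zify.

Import Order.TTheory GRing.Theory Num.Theory.
Import numFieldNormedType.Exports.

Local Open Scope classical_set_scope.
Local Open Scope ring_scope.

Set Implicit Arguments.
Unset Strict Implicit.
Unset Printing Implicit Defensive.

(** * The Frobenius inner product *)

Section frobenius.
Context {R : rcfType}.

(** The obstacle is that [S] does not commute with its summands, so [tr S^(2q+2)] cannot be expanded
    as for scalars. Replacing one observation [Y] by a copy [Y'] turns [S] into [S'] with
    [S - S' = Y - Y'], and the antisymmetry of this exchange produces the differences of powers that
    the trace inequality controls. The bound [Y^2 <= L^2 Y] keeps one factor [Y] linear, so its mean
    [C <= lambda_1] enters the recursion in place of a second [L^2]; hence a sample size of order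
    [L^2 / (lambda_1 eps^2)] and not of order [(L^2 / (lambda_1 eps))^2]. Up to the null event that
    a sample leaves [X], the exceptional event is given by a trace polynomial in the exact gradients
    at the samples. Measurability of [g] or of eigenvectors is thus never at issue, and everything
    after the concentration bound is deterministic. *)

Definition ip m n (A B : 'M[R]_(m, n)) : R := \tr (A^T *m B).

Definition fnorm m n (A : 'M[R]_(m, n)) : R := Num.sqrt (ip A A).

Definition psd m (M : 'M[R]_m) : Prop := forall v : 'cV[R]_m, 0 <= ip v (M *m v).

(** A predicate, so that bounds add, scale and transpose without handling a supremum; [specnorm] is
    needed only where the least bound matters. *)
Definition opbound m n (A : 'M[R]_(m, n)) (s : R) : Prop :=
  forall v : 'cV[R]_n, fnorm (A *m v) <= s * fnorm v.

Lemma trmxB m n (A B : 'M[R]_(m, n)) : (A - B)^T = A^T - B^T.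
Proof. exact: linearB. Qed.

Lemma trmx_sum m n I (r : seq I) (F : I -> 'M[R]_(m, n)) :
  (\sum_(i <- r) F i)^T = \sum_(i <- r) (F i)^T.
Proof. exact: linear_sum. Qed.

Lemma ipE m n (A B : 'M[R]_(m, n)) : ip A B = \sum_j \sum_i A i j * B i j.
Proof.
by apply: eq_bigr => j _; rewrite mxE; apply: eq_bigr => i _; rewrite mxE.
Qed.

Lemma ip_col m (u v : 'cV[R]_m) : ip u v = \sum_i u i 0 * v i 0.
Proof. by rewrite ipE big_ord1. Qed.

Lemma ip_cols m n (A B : 'M[R]_(m, n)) :
  ip A B = \sum_j ip (col j A) (col j B).
Proof.
by rewrite ipE; apply: eq_bigr => j _; rewrite ip_col; apply: eq_bigr => i _; rewrite !mxE.
Qed.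

Lemma ipC m n (A B : 'M[R]_(m, n)) : ip A B = ip B A.
Proof. by rewrite /ip -mxtrace_tr trmx_mul trmxK. Qed.

Lemma ipDl m n (A B C : 'M[R]_(m, n)) : ip (A + B) C = ip A C + ip B C.
Proof. by rewrite /ip linearD mulmxDl linearD. Qed.

Lemma ipDr m n (A B C : 'M[R]_(m, n)) : ip A (B + C) = ip A B + ip A C.
Proof. by rewrite ipC ipDl !(ipC _ A). Qed.

Lemma ipZl m n (a : R) (A B : 'M[R]_(m, n)) : ip (a *: A) B = a * ip A B.
Proof. by rewrite /ip linearZ -scalemxAl linearZ. Qed.

Lemma ipZr m n (a : R) (A B : 'M[R]_(m, n)) : ip A (a *: B) = a * ip A B.
Proof. by rewrite ipC ipZl ipC. Qed.

Lemma ipNl m n (A B : 'M[R]_(m, n)) : ip (- A) B = - ip A B.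
Proof. by rewrite -scaleN1r ipZl mulN1r. Qed.

Lemma ipNr m n (A B : 'M[R]_(m, n)) : ip A (- B) = - ip A B.
Proof. by rewrite ipC ipNl ipC. Qed.

Lemma ip0l m n (A : 'M[R]_(m, n)) : ip 0 A = 0.
Proof. by rewrite -(scale0r 0) ipZl mul0r. Qed.

Lemma ip_sumr m n I (r : seq I) (p : pred I) (A : 'M[R]_(m, n)) F :
  ip A (\sum_(i <- r | p i) F i) = \sum_(i <- r | p i) ip A (F i).
Proof. by rewrite /ip mulmx_sumr linear_sum. Qed.

Lemma ipMl m n p (M : 'M[R]_(m, n)) (A : 'M[R]_(n, p)) (B : 'M[R]_(m, p)) :
  ip (M *m A) B = ip A (M^T *m B).
Proof. by rewrite /ip trmx_mul mulmxA. Qed.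

Lemma ipMr m n p (A : 'M[R]_(m, n)) (M : 'M[R]_(n, p)) (B : 'M[R]_(m, p)) :
  ip (A *m M) B = ip A (B *m M^T).
Proof. by rewrite /ip trmx_mul -mulmxA mxtrace_mulC mulmxA. Qed.

Lemma ip_ge0 m n (A : 'M[R]_(m, n)) : 0 <= ip A A.
Proof. by rewrite ipE !sumr_ge0// => j _; rewrite sumr_ge0// => i _; rewrite -expr2 sqr_ge0. Qed.

Lemma ip_eq0 m n (A : 'M[R]_(m, n)) : (ip A A == 0) = (A == 0).
Proof.
apply/eqP/eqP => [|->]; last by rewrite ip0l.
rewrite ipE => /eqP; rewrite psumr_eq0; last first.
  by move=> j _; rewrite sumr_ge0// => i _; rewrite -expr2 sqr_ge0.
move=> /allP h; apply/matrixP => i j; rewrite mxE.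
have /= := h j; rewrite mem_index_enum => /(_ isT); rewrite psumr_eq0; last first.
  by move=> k _; rewrite -expr2 sqr_ge0.
by move=> /allP/(_ i); rewrite mem_index_enum /= mulf_eq0 orbb => /(_ isT)/eqP.
Qed.

Lemma ip_amgm m n (A B : 'M[R]_(m, n)) : 2 * ip A B <= ip A A + ip B B.
Proof.
have := ip_ge0 (A - B); rewrite ipDl !ipDr !ipNl !ipNr (ipC B A); lra.
Qed.

Lemma ip_cauchy m n (A B : 'M[R]_(m, n)) : ip A B ^+ 2 <= ip A A * ip B B.
Proof.
have [/eqP|B0] := eqVneq (ip B B) 0.
  by rewrite ip_eq0 => /eqP->; rewrite ipC !ip0l mulr0 expr0n.
have Bgt0 : 0 < ip B B by rewrite lt_def B0 ip_ge0.
have := ip_ge0 (ip B B *: A - ip A B *: B).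
rewrite ipDl !ipDr !ipNl !ipNr !ipZl !ipZr (ipC B A).
rewrite (_ : _ + _ = ip B B * (ip A A * ip B B - ip A B ^+ 2)); last by ring.
by rewrite pmulr_rge0// subr_ge0.
Qed.

Lemma sqr_fnorm m n (A : 'M[R]_(m, n)) : fnorm A ^+ 2 = ip A A.
Proof. by rewrite sqr_sqrtr// ip_ge0. Qed.

Lemma fnorm_ge0 m n (A : 'M[R]_(m, n)) : 0 <= fnorm A.
Proof. exact: sqrtr_ge0. Qed.

Lemma fnorm_eq0 m n (A : 'M[R]_(m, n)) : (fnorm A == 0) = (A == 0).
Proof. by rewrite -ip_eq0 -sqr_fnorm sqrf_eq0. Qed.

Lemma fnorm0 m n : fnorm (0 : 'M[R]_(m, n)) = 0.
Proof. by apply/eqP; rewrite fnorm_eq0. Qed.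

Lemma ip_le_fnorm m n (A B : 'M[R]_(m, n)) : `|ip A B| <= fnorm A * fnorm B.
Proof.
rewrite -ler_sqr ?nnegrE ?mulr_ge0 ?fnorm_ge0//.
by rewrite exprMn !sqr_fnorm real_normK ?num_real// ip_cauchy.
Qed.

Lemma fnormD m n (A B : 'M[R]_(m, n)) : fnorm (A + B) <= fnorm A + fnorm B.
Proof.
rewrite -ler_sqr ?nnegrE ?addr_ge0 ?fnorm_ge0// sqrrD !sqr_fnorm.
rewrite ipDl !ipDr (ipC B A).
have := le_trans (ler_norm _) (ip_le_fnorm A B); lra.
Qed.

Lemma fnormZ m n (a : R) (A : 'M[R]_(m, n)) : fnorm (a *: A) = `|a| * fnorm A.
Proof.
by rewrite /fnorm ipZl ipZr mulrA -expr2 sqrtrM ?sqr_ge0// sqrtr_sqr.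
Qed.

Lemma fnormN m n (A : 'M[R]_(m, n)) : fnorm (- A) = fnorm A.
Proof. by rewrite /fnorm ipNl ipNr opprK. Qed.

Lemma fnorm_sum m n I (r : seq I) (F : I -> 'M[R]_(m, n)) :
  fnorm (\sum_(i <- r) F i) <= \sum_(i <- r) fnorm (F i).
Proof.
elim/big_rec2 : _ => [|i x y _ h]; first by rewrite fnorm0.
exact: le_trans (fnormD _ _) (lerD _ _).
Qed.

(** * Bounds on operator norms *)

Lemma opboundD m n (A B : 'M[R]_(m, n)) s t :
  opbound A s -> opbound B t -> opbound (A + B) (s + t).
Proof.
move=> hA hB v; rewrite mulmxDl mulrDl.
exact: le_trans (fnormD _ _) (lerD (hA v) (hB v)).
Qed.

Lemma opboundN m n (A : 'M[R]_(m, n)) s : opbound A s -> opbound (- A) s.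
Proof. by move=> hA v; rewrite mulNmx fnormN. Qed.

Lemma opboundZ m n (a : R) (A : 'M[R]_(m, n)) s :
  opbound A s -> opbound (a *: A) (`|a| * s).
Proof. by move=> hA v; rewrite -scalemxAl fnormZ -mulrA ler_wpM2l. Qed.

Lemma opbound_sum m n I (r : seq I) (F : I -> 'M[R]_(m, n)) s :
  (forall i, opbound (F i) (s i)) ->
  opbound (\sum_(i <- r) F i) (\sum_(i <- r) s i).
Proof.
move=> h v; rewrite mulmx_suml mulr_suml; apply: le_trans (fnorm_sum _ _) _.
by apply: ler_sum => i _; exact: h.
Qed.

Lemma opbound_le m n (A : 'M[R]_(m, n)) s t :
  s <= t -> opbound A s -> opbound A t.
Proof.
by move=> st h v; apply: le_trans (h v) _; rewrite ler_wpM2r ?fnorm_ge0.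
Qed.

Lemma fnorm_outer m (u w v : 'cV[R]_m) :
  fnorm (u *m w^T *m v) <= fnorm u * fnorm w * fnorm v.
Proof.
have -> : u *m w^T *m v = ip w v *: u.
  rewrite -mulmxA; apply/matrixP => i j; rewrite !mxE big_ord1 [j]ord1 mulrC.
  congr (_ * _); rewrite ip_col mxE; apply: eq_bigr => k _.
  by rewrite !mxE.
by rewrite fnormZ mulrC -mulrA ler_wpM2l ?fnorm_ge0// ip_le_fnorm.
Qed.

(** With [r = u - w], the difference is [r r^T + r w^T + w r^T], in which every factor is bounded by
    [e] or [L]; this is the origin of the gradient error term. *)
Lemma opbound_outer_diff m (u w : 'cV[R]_m) (e L : R) :
  fnorm (u - w) <= e -> fnorm w <= L ->
  opbound (u *m u^T - w *m w^T) (e * (e + 2 * L)).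
Proof.
move=> he hL v.
have -> : u *m u^T - w *m w^T = (u - w) *m (u - w)^T + ((u - w) *m w^T + w *m (u - w)^T).
  rewrite [(u - w)^T]linearB !mulmxBl !mulmxBr.
  move: (u *m u^T) (u *m w^T) (w *m u^T) (w *m w^T) => a b c d.
  by apply/matrixP => i j; rewrite !mxE; ring.
have e0 : 0 <= e by apply: le_trans he; exact: fnorm_ge0.
have L0 : 0 <= L by apply: le_trans hL; exact: fnorm_ge0.
rewrite 2!mulmxDl; apply: le_trans (fnormD _ _) _.
apply: le_trans (lerD (fnorm_outer _ _ _) (le_trans (fnormD _ _)
  (lerD (fnorm_outer _ _ _) (fnorm_outer _ _ _)))) _.
rewrite -!mulrDl ler_wpM2r ?fnorm_ge0//.
rewrite (_ : e * (e + 2 * L) = e * e + (e * L + L * e)); last by ring.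
by rewrite !lerD// ler_pM ?fnorm_ge0.
Qed.

Lemma psd_ip m n (M : 'M[R]_m) (B : 'M[R]_(m, n)) : psd M -> 0 <= ip B (M *m B).
Proof.
move=> h; rewrite ip_cols sumr_ge0// => j _.
by rewrite !colE -mulmxA -!colE.
Qed.

End frobenius.

(** * Trace inequalities for powers of symmetric matrices *)

Lemma trmxX (R : comPzRingType) m (A : 'M[R]_m) n : (A ^+ n)^T = A^T ^+ n.
Proof.
elim: n => [|n IH]; first by rewrite !expr0 trmx1.
by rewrite exprSr exprS -!mulmxE trmx_mul IH.
Qed.

(** Telescoping that keeps the order of the factors, as a sum and its exchanged version do not
    commute. *)
Lemma subrXX_noncomm (R : pzRingType) (a b : R) n :
  a ^+ n.+1 - b ^+ n.+1 = \sum_(k < n.+1) a ^+ k * (a - b) * b ^+ (n - k).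
Proof.
elim: n => [|n IH]; first by rewrite big_ord1 !expr0 mulr1 mul1r !expr1.
have -> : a ^+ n.+2 - b ^+ n.+2 =
    a ^+ n.+1 * (a - b) + (a ^+ n.+1 - b ^+ n.+1) * b.
  by rewrite mulrBl mulrBr -!exprSr addrA subrK.
rewrite IH [RHS]big_ord_recr /= subnn expr0 mulr1 addrC; congr (_ + _).
rewrite mulr_suml; apply: eq_bigr => k _.
by rewrite -mulrA -exprSr subSn// -ltnS.
Qed.

(** * Averages of convex sequences *)

Section convex_sequences.
Context {R : realFieldType}.

Lemma convex_seq_incr (e : nat -> R) q :
  (forall i, (i.+2 <= q)%N -> 2 * e i.+1 <= e i + e i.+2) ->
  forall i j, (i + j.+1 <= q)%N -> e i.+1 - e i <= e (i + j).+1 - e (i + j)%N.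
Proof.
move=> h i; elim=> [|j IH] ij; first by rewrite addn0.
have := h (i + j)%N; have := IH; rewrite !addnS in ij *.
move=> /(_ (ltnW ij)) + /(_ ij); lra.
Qed.

(** Increments are nondecreasing, so raising the lower index by one gains at most what raising the
    index [i + j] by one gains. *)
Lemma convex_seq_ends (e : nat -> R) q :
  (forall i, (i.+2 <= q)%N -> 2 * e i.+1 <= e i + e i.+2) ->
  forall i, (i <= q)%N -> e i + e (q - i)%N <= e 0%N + e q.
Proof.
move=> h.
suff H i j : (i + j <= q)%N -> e i + e j <= e 0%N + e (i + j)%N.
  by move=> i iq; have := H i (q - i)%N; rewrite subnKC//; apply.
elim: i => [|i IH] ij; first by rewrite add0n.
have := convex_seq_incr h (i := i) (j := j).
rewrite addnS => /(_ ij); have := IH (ltnW ij); rewrite addSn; lra.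
Qed.

Lemma sum_parity (f : nat -> R) q :
  \sum_(k < q.*2.+1) f k = \sum_(i < q.+1) f i.*2 + \sum_(i < q) f i.*2.+1.
Proof.
elim: q => [|q IH]; first by rewrite !big_ord1 big_ord0 addr0.
rewrite doubleS big_ord_recr big_ord_recr /= IH.
by rewrite [X in _ = X + _]big_ord_recr [X in _ = _ + X]big_ord_recr /= doubleS; ring.
Qed.

(** The hypothesis compares only with values at even indices. These form a convex sequence and are
    paired symmetrically about the middle; each value at an odd index is first replaced by the mean
    of its two even neighbours. The counts [q + 1] and [q] add up to [2q + 1]. *)
Lemma midpoint_convex_sum (f : nat -> R) q :
  (forall i j, (i <= q)%N -> (j <= q)%N -> 2 * f (i + j)%N <= f i.*2 + f j.*2) ->
  2 * \sum_(k < q.*2.+1) f k <= q.*2.+1%:R * (f 0%N + f q.*2).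
Proof.
move=> h; pose e i := f i.*2.
have ce i : (i.+2 <= q)%N -> 2 * e i.+1 <= e i + e i.+2.
  move=> iq; have := h i i.+2; rewrite addnS addnS addnn -doubleS; apply; lia.
have ends := convex_seq_ends ce.
have even : 2 * \sum_(i < q.+1) e i <= q.+1%:R * (e 0%N + e q).
  rewrite !mulr_natl mulr2n {2}(reindex_inj rev_ord_inj) -big_split /=.
  rewrite -[X in _ *+ X]card_ord -sumr_const; apply: ler_sum => i _.
  by rewrite subSS; apply: ends; rewrite -ltnS.
have odd : 2 * \sum_(i < q) f i.*2.+1 <= q%:R * (e 0%N + e q).
  rewrite mulr_sumr.
  have : \sum_(i < q) 2 * f i.*2.+1 <= \sum_(i < q) e i + \sum_(i < q) e i.+1.
    rewrite -big_split /=; apply: ler_sum => i _.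
    have := h i i.+1; rewrite addnS addnn; apply; have := ltn_ord i; lia.
  move=> /le_trans; apply.
  rewrite [X in _ + X](reindex_inj rev_ord_inj) -big_split /=.
  rewrite mulr_natl -[X in _ *+ X]card_ord -sumr_const; apply: ler_sum => i _.
  by rewrite -subSn ?subSS; [apply: ends; exact: ltnW|].
rewrite sum_parity mulrDr; apply: le_trans (lerD even odd) _.
by rewrite -mulrDl -natrD addSn addnn.
Qed.

End convex_sequences.

Section trace_powers.
Context {R : rcfType} {m : nat}.
Implicit Types A B D S H : 'M[R]_m.

Lemma ip_trmx A B : ip A^T B^T = ip A B.
Proof. by rewrite /ip trmxK -mxtrace_tr trmx_mul trmxK mxtrace_mulC. Qed.

(* [k |-> tr (D A^k D B^(2q-k))] is midpoint convex by Cauchy-Schwarz, since it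
   is a Gram matrix [ip V_i V_j] depending on [i + j] only; its average is thus
   bounded by the mean of its extreme values. *)
Lemma ip_subX A B q : A^T = A -> B^T = B ->
  2 * ip (A - B) (A ^+ q.*2.+1 - B ^+ q.*2.+1) <=
  q.*2.+1%:R * (ip ((A - B) *m A ^+ q) ((A - B) *m A ^+ q) +
                ip ((A - B) *m B ^+ q) ((A - B) *m B ^+ q)).
Proof.
move=> sA sB; set D := A - B.
have sD : D^T = D by rewrite /D linearB /= sA sB.
pose f k := ip D (A ^+ k *m D *m B ^+ (q.*2 - k)).
pose V i := A ^+ i *m D *m B ^+ (q - i).
have fV i j : (i <= q)%N -> (j <= q)%N -> f (i + j)%N = ip (V i) (V j).
  move=> iq jq; rewrite /V -[A ^+ i *m D *m _]mulmxA ipMl ipMr !trmxX sA sB /f exprD.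
  rewrite (_ : q.*2 - _ = q - j + (q - i))%N; last by lia.
  by rewrite exprD -!mulmxE !mulmxA.
rewrite subrXX_noncomm ip_sumr -/D.
have -> : \sum_(i < q.*2.+1) ip D (A ^+ i * D * B ^+ (q.*2 - i)) =
  \sum_(i < q.*2.+1) f i by [].
have f0 : f 0%N = ip (D *m B ^+ q) (D *m B ^+ q).
  by rewrite (fV 0%N 0%N)// /V expr0 subn0 mul1mx.
have fq : f q.*2 = ip (D *m A ^+ q) (D *m A ^+ q).
  rewrite -addnn fV// /V subnn expr0 mulmx1.
  by rewrite -ip_trmx trmx_mul sD trmxX sA.
rewrite -f0 -fq addrC [X in _ <= _ * X]addrC addrC.
apply: le_trans (midpoint_convex_sum _) _ => [i j iq jq|]; last by rewrite addrC.
by rewrite -!addnn !fV//; exact: ip_amgm.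
Qed.

Lemma trX_ip S i j : S^T = S -> \tr (S ^+ (i + j)) = ip (S ^+ i) (S ^+ j).
Proof. by move=> sS; rewrite /ip trmxX sS exprD. Qed.

Lemma trX_double_ge0 S q : S^T = S -> 0 <= \tr (S ^+ q.*2).
Proof. by move=> sS; rewrite -addnn trX_ip// ip_ge0. Qed.

(** The square of [S^(q+1) - a S^q] has nonnegative trace. This trades an odd trace power, which has
    no sign, for the two even ones next to it. *)
Lemma trX_young S (a : R) q : S^T = S ->
  2 * a * \tr (S ^+ q.*2.+1) <= \tr (S ^+ q.+1.*2) + a ^+ 2 * \tr (S ^+ q.*2).
Proof.
move=> sS; have := ip_amgm (S ^+ q.+1) (a *: S ^+ q).
rewrite ipZl !ipZr -!trX_ip// addSn !addnn; lra.
Qed.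

(** [(H - H')^2 <= 2 H^2 + 2 H'^2] by the parallelogram law, and each square is at most [k] times
    the matrix itself. *)
Lemma ip_sub_le H H' (k : R) n (Q : 'M[R]_(m, n)) : H^T = H -> H'^T = H' ->
  psd (k *: H - H *m H) -> psd (k *: H' - H' *m H') ->
  ip ((H - H') *m Q) ((H - H') *m Q) <= 2 * k * ip Q ((H + H') *m Q).
Proof.
move=> sH sH' pH pH'; rewrite mulmxBl mulmxDl.
have P : forall K, K^T = K -> psd (k *: K - K *m K) ->
    ip (K *m Q) (K *m Q) <= k * ip Q (K *m Q).
  move=> K sK pK; have := psd_ip Q pK.
  by rewrite mulmxBl ipDr ipNr -scalemxAl ipZr ipMl sK mulmxA subr_ge0.
have := P _ sH pH; have := P _ sH' pH'.
move: (H *m Q) (H' *m Q) => u v; have := ip_ge0 (u + v).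
rewrite !ipDl !ipDr !ipNl !ipNr (ipC v u); lra.
Qed.

(** Cauchy-Schwarz for [M] against the rank one matrix [M v v^T]. *)
Lemma fnorm_mulmx n p (M : 'M[R]_(n, p)) (v : 'cV[R]_p) :
  fnorm (M *m v) <= fnorm M * fnorm v.
Proof.
have [->|Mv0] := eqVneq (M *m v) 0.
  by rewrite fnorm0 mulr_ge0 ?fnorm_ge0.
have Mvgt0 : 0 < fnorm (M *m v) by rewrite lt_def fnorm_eq0 Mv0 fnorm_ge0.
have outer : fnorm (M *m v *m v^T) = fnorm (M *m v) * fnorm v.
  rewrite -[RHS]ger0_norm ?mulr_ge0 ?fnorm_ge0// -sqrtr_sqr exprMn !sqr_fnorm.
  congr Num.sqrt; move: (M *m v) => u.
  rewrite ipMr trmxK -mulmxA.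
  have -> : v^T *m v = (ip v v)%:M.
    by rewrite [v^T *m v]mx11_scalar /ip /mxtrace big_ord1.
  by rewrite mul_mx_scalar ipZr mulrC.
rewrite -(ler_pM2l Mvgt0) -expr2 sqr_fnorm.
have -> : ip (M *m v) (M *m v) = ip (M *m v *m v^T) M by rewrite [RHS]ipMr trmxK.
apply: le_trans (ler_norm _) (le_trans (ip_le_fnorm _ _) _).
by rewrite outer -mulrA [fnorm v * _]mulrC.
Qed.

(** No diagonalization is involved: for symmetric [S] the sequence [|S^k v|] is log-convex, whence
    [|S v|^p <= |S^p v| |v|^(p-1)], and the Frobenius norm of [S^p] is the square root of
    [tr S^(2p)]. *)
Lemma opbound_trX S (t : R) p : S^T = S -> 0 <= t -> (0 < p)%N ->
  \tr (S ^+ p.*2) <= t ^+ p.*2 -> opbound S t.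
Proof.
move=> sS t0 p0 Sp v; pose c k := fnorm (S ^+ k *m v).
have c_ge0 k : 0 <= c k by exact: fnorm_ge0.
have cS k : S ^+ k.+1 *m v = S *m (S ^+ k *m v) by rewrite exprS -mulmxA.
have logc k : c k.+1 ^+ 2 <= c k * c k.+2.
  apply: le_trans (le_trans (ler_norm _) (ip_le_fnorm _ _)).
  by rewrite sqr_fnorm {1}cS ipMl sS -cS.
(* Log-convexity makes the ratios [c (k+1) / c k] nondecreasing; the cross-multiplied form also
   covers vanishing terms. *)
have c1 k : c k * c 1%N <= c k.+1 * c 0%N.
  elim: k => [|k IH]; first by rewrite mulrC.
  have [ck|ck] := eqVneq (c k) 0.
    have -> : c k.+1 = 0.
      apply/eqP; rewrite fnorm_eq0 cS.
      by move/eqP: ck; rewrite fnorm_eq0 => /eqP->; rewrite mulmx0.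
    by rewrite mul0r mulr_ge0.
  have ckgt0 : 0 < c k by rewrite lt_def ck c_ge0.
  rewrite -(ler_pM2l ckgt0) mulrCA; apply: le_trans (ler_wpM2l (c_ge0 _) IH) _.
  by rewrite !mulrA ler_wpM2r// -expr2.
have cX k : c 1%N ^+ k.+1 <= c k.+1 * c 0%N ^+ k.
  elim: k => [|k IH]; first by rewrite expr0 mulr1 expr1.
  rewrite exprSr; apply: le_trans (ler_wpM2r (c_ge0 _) IH) _.
  by rewrite mulrAC [c 0%N ^+ k.+1]exprS mulrA ler_wpM2r ?exprn_ge0.
have Spt : fnorm (S ^+ p) <= t ^+ p.
  by rewrite -ler_sqr ?nnegrE ?fnorm_ge0 ?exprn_ge0// sqr_fnorm -trX_ip// addnn -exprM muln2.
have -> : S *m v = S ^+ 1 *m v by rewrite expr1.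
rewrite -(@ler_pXn2r _ p) ?nnegrE ?mulr_ge0 ?fnorm_ge0//.
case: p p0 {Sp} Spt => // p _ Spt; apply: le_trans (cX p) _.
rewrite /c expr0 mul1mx exprMn [fnorm v ^+ p.+1]exprS mulrA.
rewrite ler_wpM2r ?exprn_ge0 ?fnorm_ge0//.
by apply: le_trans (fnorm_mulmx _ _) _; rewrite ler_wpM2r ?fnorm_ge0.
Qed.

End trace_powers.

(** * Perturbation of eigenspaces *)

Section operator_norm.
Context {R : realType}.

Lemma vnormE m (v : 'cV[R]_m) : vnorm v = fnorm v.
Proof.
by rewrite /vnorm /fnorm ip_col; congr Num.sqrt; apply: eq_bigr => i _; rewrite expr2.
Qed.

Lemma specnorm_le m n (A : 'M[R]_(m, n)) s : 0 <= s -> opbound A s -> specnorm A <= s.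
Proof.
move=> s0 h; apply: sup_le_ub.
  by exists (vnorm (A *m 0)), 0 => //=; rewrite vnormE fnorm0.
move=> _ [v /= v1 <-]; rewrite !vnormE in v1 *.
by apply: le_trans (h v) _; rewrite ler_piMr.
Qed.

Lemma opbound_specnorm m n (A : 'M[R]_(m, n)) : opbound A (specnorm A).
Proof.
move=> v; have [->|v0] := eqVneq v 0; first by rewrite mulmx0 !fnorm0 mulr0.
have vgt0 : 0 < fnorm v by rewrite lt_def fnorm_eq0 v0 fnorm_ge0.
rewrite -ler_pdivrMr//; apply: ub_le_sup.
  exists (fnorm A) => _ [u /= u1 <-]; rewrite !vnormE in u1 *.
  by apply: le_trans (fnorm_mulmx _ _) _; rewrite ler_piMr ?fnorm_ge0.
exists ((fnorm v)^-1 *: v); rewrite /= vnormE.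
  by rewrite fnormZ ger0_norm ?invr_ge0 ?fnorm_ge0// mulVf ?gt_eqF.
by rewrite -scalemxAr fnormZ ger0_norm ?invr_ge0 ?fnorm_ge0// mulrC.
Qed.

Lemma specnorm_ge0 m n (A : 'M[R]_(m, n)) : 0 <= specnorm A.
Proof.
apply: ub_le_sup => [|/=].
  exists (fnorm A) => _ [u /= u1 <-]; rewrite !vnormE in u1 *.
  by apply: le_trans (fnorm_mulmx _ _) _; rewrite ler_piMr ?fnorm_ge0.
by exists 0; rewrite /= ?mulmx0 !vnormE fnorm0.
Qed.

Lemma opboundT m n (A : 'M[R]_(m, n)) s : 0 <= s -> opbound A s -> opbound A^T s.
Proof.
move=> s0 h v; have [->|Av0] := eqVneq (A^T *m v) 0.
  by rewrite fnorm0 mulr_ge0 ?fnorm_ge0.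
have Avgt0 : 0 < fnorm (A^T *m v) by rewrite lt_def fnorm_eq0 Av0 fnorm_ge0.
rewrite -(ler_pM2l Avgt0) -expr2 sqr_fnorm {1}ipMl trmxK ipC.
apply: le_trans (ler_norm _) (le_trans (ip_le_fnorm _ _) _).
by rewrite mulrA [_ * s]mulrC ler_wpM2r ?fnorm_ge0.
Qed.

(* [Z = P Q] solves the Sylvester equation [A Z = Z B Q - P (B - A) Q], so its
   norm [s] satisfies [a s <= s b + e]. *)
Lemma sylvester_bound m (A B P Q : 'M[R]_m) (a b e : R) :
  P *m A = A *m P -> Q *m B = B *m Q -> Q *m Q = Q ->
  (forall v : 'cV[R]_m, a * fnorm (P *m v) <= fnorm (A *m P *m v)) ->
  opbound (B *m Q) b -> opbound (B - A) e -> opbound P 1 -> opbound Q 1 ->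
  0 <= e -> 0 <= b -> b < a -> opbound (P *m Q) (e / (a - b)).
Proof.
move=> PA QB QQ lowA upB he P1 Q1 e0 b0 ba.
set Z := P *m Q; set s := specnorm Z.
have s0 : 0 <= s by exact: specnorm_ge0.
have a0 : 0 < a by exact: le_lt_trans ba.
suff sle : s <= e / (a - b) by exact: opbound_le sle (opbound_specnorm Z).
have key : opbound Z ((s * b + e) / a).
  move=> v; rewrite mulrAC ler_pdivlMr// mulrC.
  rewrite -[Z]/(P *m Q) -mulmxA; apply: le_trans (lowA _) _.
  have -> : A *m P *m (Q *m v) = Z *m (B *m Q *m v) - P *m ((B - A) *m (Q *m v)).
    rewrite mulmxBl mulmxBr opprB /Z !mulmxA -[P *m Q *m B]mulmxA QB.
    rewrite -[P *m (B *m Q) *m Q]mulmxA -[B *m Q *m Q]mulmxA QQ.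
    by rewrite PA !mulmxA addrC subrK.
  apply: le_trans (fnormD _ _) _; rewrite fnormN mulrDl; apply: lerD.
    apply: le_trans (opbound_specnorm Z _) _.
    by rewrite -mulrA ler_wpM2l.
  apply: le_trans (P1 _) _; rewrite mul1r; apply: le_trans (he _) _.
  by rewrite ler_wpM2l// -[leRHS]mul1r.
have : s <= (s * b + e) / a.
  by apply: specnorm_le key; rewrite divr_ge0 ?addr_ge0 ?mulr_ge0 ?(ltW a0).
rewrite ler_pdivlMr// ler_pdivlMr ?subr_gt0//; lra.
Qed.

End operator_norm.

(** * Functional calculus in an orthonormal eigenbasis *)

Section spectral_calculus.
Context {R : realType} {m : nat} (W : 'M[R]_m).
Hypothesis W_orth : W^T *m W = 1%:M.
Implicit Types (f g : nat -> R) (v : 'cV[R]_m).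

(** The function is read on the index and not on the eigenvalue, so the projector onto the first [n]
    columns is also of this form, whatever the multiplicities. Indices start at 0 here, hence
    [lam i.+1] for the eigenvalues. *)
Definition spec_fun f : 'M[R]_m := W *m diag_mx (\row_(i < m) f i) *m W^T.

Let W_orth' : W *m W^T = 1%:M. Proof. exact: mulmx1C. Qed.

Lemma fnorm_orth v : fnorm (W^T *m v) = fnorm v.
Proof. by rewrite /fnorm ipMl trmxK mulmxA W_orth' mul1mx. Qed.

Lemma spec_fun_tr f : (spec_fun f)^T = spec_fun f.
Proof. by rewrite /spec_fun !trmx_mul trmxK tr_diag_mx mulmxA. Qed.

Lemma spec_fun_coord f v i : (W^T *m (spec_fun f *m v)) i 0 = f i * (W^T *m v) i 0.
Proof. by rewrite /spec_fun !mulmxA W_orth mul1mx -mulmxA mul_diag_mx !mxE. Qed.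

Lemma spec_funM f g : spec_fun f *m spec_fun g = spec_fun (fun i => f i * g i).
Proof.
rewrite /spec_fun -!mulmxA [W^T *m (W *m _)]mulmxA W_orth mul1mx.
rewrite [diag_mx _ *m (diag_mx _ *m _)]mulmxA mulmx_diag.
by congr (_ *m (diag_mx _ *m _)); apply/rowP => i; rewrite !mxE.
Qed.

Lemma spec_fun1 : spec_fun (fun=> 1) = 1%:M.
Proof.
rewrite /spec_fun (_ : diag_mx _ = 1%:M) ?mulmx1//.
by apply/matrixP => i j; rewrite !mxE.
Qed.

Lemma spec_funB f g : spec_fun f - spec_fun g = spec_fun (fun i => f i - g i).
Proof.
rewrite /spec_fun -mulmxBl -mulmxBr; congr (_ *m _ *m _).
by apply/matrixP => i j; rewrite !mxE mulrnBl.
Qed.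

Lemma ip_spec_fun f v : ip v (spec_fun f *m v) = \sum_(i < m) f i * (W^T *m v) i 0 ^+ 2.
Proof.
have -> : ip v (spec_fun f *m v) = ip (W^T *m v) (W^T *m (spec_fun f *m v)).
  by rewrite [RHS]ipMl trmxK [W *m (W^T *m _)]mulmxA W_orth' mul1mx.
rewrite ip_col; apply: eq_bigr => i _.
by rewrite spec_fun_coord mulrCA expr2.
Qed.

Lemma sqr_fnorm_orth v : fnorm v ^+ 2 = \sum_(i < m) (W^T *m v) i 0 ^+ 2.
Proof. by rewrite -fnorm_orth sqr_fnorm ip_col; apply: eq_bigr => i _; rewrite expr2. Qed.

Lemma fnorm_spec_fun_le f g v : (forall i, (i < m)%N -> `|f i| <= `|g i|) ->
  fnorm (spec_fun f *m v) <= fnorm (spec_fun g *m v).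
Proof.
move=> fg; rewrite -ler_sqr ?nnegrE ?fnorm_ge0// !sqr_fnorm_orth.
apply: ler_sum => i _; rewrite !spec_fun_coord !exprMn ler_wpM2r ?sqr_ge0//.
by rewrite -[f i ^+ 2]real_normK ?num_real// -[g i ^+ 2]real_normK ?num_real// ler_sqr ?nnegrE// fg.
Qed.

Lemma fnorm_spec_cst (a : R) v : fnorm (spec_fun (fun=> a) *m v) = `|a| * fnorm v.
Proof.
rewrite -fnormZ; congr fnorm.
have -> : spec_fun (fun=> a) = a *: spec_fun (fun=> 1).
  rewrite /spec_fun scalemxAl scalemxAr; congr (_ *m _ *m _).
  by apply/matrixP => i j; rewrite !mxE mulrnAr mulr1.
by rewrite spec_fun1 -scalemxAl mul1mx.
Qed.

Lemma ip_spec_fun_col f (i : 'I_m) : ip (col i W) (spec_fun f *m col i W) = f i.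
Proof.
rewrite colE ip_spec_fun mulmxA W_orth mul1mx (bigD1 i) //= big1 => [|j ji].
  by rewrite mxE !eqxx expr1n mulr1 addr0.
by rewrite mxE (negbTE ji) expr0n mulr0.
Qed.

Lemma spec_fun_psd f : psd (spec_fun f) -> forall i, (i < m)%N -> 0 <= f i.
Proof. by move=> h i im; have := h (col (Ordinal im) W); rewrite ip_spec_fun_col. Qed.

Lemma first_cols_spec n (nm : (n <= m)%N) :
  first_cols nm W *m (first_cols nm W)^T = spec_fun (fun i => (i < n)%:R).
Proof.
apply/matrixP => i j; rewrite /spec_fun mul_mx_diag !mxE.
transitivity (\sum_(k < m | (k < n)%N) W i k * W j k).
  rewrite (big_ord_narrow nm); apply: eq_bigr => k _.
  by rewrite !mxE.
rewrite big_mkcond; apply: eq_bigr => k _; rewrite !mxE.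
by case: ifP; rewrite ?mulr1// mulr0 mul0r.
Qed.

End spectral_calculus.

(** * Eigenvalue inequalities and distance of leading eigenspaces *)

Section eigenspaces.
Context {R : realType} {m : nat}.
Implicit Types (W U A B : 'M[R]_m) (lam theta : nat -> R).

Lemma eigen_decompositionE A W lam :
  eigen_decomposition A W lam -> A = spec_fun W (fun i => lam i.+1).
Proof. by case. Qed.

(* The conditions [(U^T v) i = 0] for [i > k] and [(W^T v) i = 0] for [i < k]
   are [m - 1] linear equations on [v]. *)
Lemma common_vector W U (k : 'I_m) : U^T *m U = 1%:M -> exists2 v : 'cV[R]_m, v != 0 &
  (forall i : 'I_m, (k < i)%N -> (U^T *m v) i 0 = 0) /\
  (forall i : 'I_m, (i < k)%N -> (W^T *m v) i 0 = 0).
Proof.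
move=> UU.
pose K : 'M[R]_m := \matrix_(i, j)
  if (i < k)%N then (W^T *m U) i j else if (k < i)%N then (i == j)%:R else 0.
have : \det K^T = 0.
  by rewrite det_tr (expand_det_row K k) big1// => j _; rewrite mxE !ltnn mul0r.
move=> /eqP/det0P[y y0 yK].
have Ky : K *m y^T = 0 by rewrite -[K]trmxK -trmx_mul yK trmx0.
exists (U *m y^T).
  apply: contra_neq y0 => Uy; have : U^T *m (U *m y^T) = 0 by rewrite Uy mulmx0.
  by rewrite mulmxA UU mul1mx => h; rewrite -[y]trmxK h trmx0.
split=> i ki.
  rewrite mulmxA UU mul1mx; have := congr1 (fun M : 'cV_m => M i 0) Ky.
  rewrite mxE [RHS]mxE (bigD1 i)//= big1 => [|j ji].
    by rewrite mxE ki ltnNge (ltnW ki) /= eqxx mul1r addr0.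
  by rewrite mxE ki ltnNge (ltnW ki) /= eq_sym (negbTE ji) mul0r.
have := congr1 (fun M : 'cV_m => M i 0) Ky.
rewrite mulmxA mxE [RHS]mxE => <-; rewrite [LHS]mxE; apply: eq_bigr => j _.
by rewrite [K i j]mxE ki.
Qed.

(** The common vector [v] lies in the span of the leading [k + 1] eigenvectors of [B] and of the
    trailing [m - k] of [A], so the form of [B] at [v] is at least [theta k.+1] and that of [A] at
    most [lam k.+1], relative to [|v|^2]. *)
Lemma weyl A B W U lam theta (e : R) (k : nat) :
  eigen_decomposition A W lam -> eigen_decomposition B U theta ->
  opbound (B - A) e -> (k < m)%N -> theta k.+1 <= lam k.+1 + e.
Proof.
move=> dA dB he km; have [WW _ lam_le] := dA; have [UU _ theta_le] := dB.
have [v v0 [vU vW]] := @common_vector W U (Ordinal km) UU.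
have vgt0 : 0 < fnorm v ^+ 2.
  by rewrite exprn_gt0// lt_def fnorm_eq0 v0 fnorm_ge0.
rewrite -(ler_pM2r vgt0) mulrDl.
have lowB : theta k.+1 * fnorm v ^+ 2 <= ip v (B *m v).
  rewrite (eigen_decompositionE dB) ip_spec_fun// (sqr_fnorm_orth UU) mulr_sumr.
  apply: ler_sum => i _; have [ik|ki] := leqP i k.
    by rewrite ler_wpM2r ?sqr_ge0// theta_le.
  by rewrite vU// expr0n /= !mulr0.
have upA : ip v (A *m v) <= lam k.+1 * fnorm v ^+ 2.
  rewrite (eigen_decompositionE dA) ip_spec_fun// (sqr_fnorm_orth WW) mulr_sumr.
  apply: ler_sum => i _; have [ki|ik] := leqP k i.
    by rewrite ler_wpM2r ?sqr_ge0// lam_le.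
  by rewrite vW// expr0n /= !mulr0.
have dif : ip v ((B - A) *m v) <= e * fnorm v ^+ 2.
  apply: le_trans (ler_norm _) (le_trans (ip_le_fnorm _ _) _).
  by rewrite expr2 mulrA [e * _]mulrC -mulrA ler_wpM2l ?fnorm_ge0.
have : ip v (B *m v) = ip v (A *m v) + ip v ((B - A) *m v).
  by rewrite mulmxBl ipDr ipNr addrC subrK.
lra.
Qed.

(** [Q - P = Q (1 - P) - (1 - Q) P] splits into terms with orthogonal ranges that act on the
    orthogonal components [(1 - P) v] and [P v]; Pythagoras on both sides gives [s] and not
    [2 s]. *)
Lemma opbound_projector_diff (P Q : 'M[R]_m) (s : R) : 0 <= s ->
  P^T = P -> Q^T = Q -> P *m P = P -> Q *m Q = Q ->
  opbound (P *m (1%:M - Q)) s -> opbound (Q *m (1%:M - P)) s ->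
  opbound (Q - P) s.
Proof.
move=> s0 sP sQ PP QQ PQ QP v.
have sP' : (1%:M - P)^T = 1%:M - P by rewrite linearB /= trmx1 sP.
have sQ' : (1%:M - Q)^T = 1%:M - Q by rewrite linearB /= trmx1 sQ.
have Q'P : opbound ((1%:M - Q) *m P) s.
  by rewrite -[_ *m _]trmxK trmx_mul sP sQ'; exact: opboundT.
have P'P' : (1%:M - P) *m (1%:M - P) = 1%:M - P.
  by rewrite mulmxBl mul1mx mulmxBr mulmx1 PP subrr subr0.
rewrite -ler_sqr ?nnegrE ?mulr_ge0 ?fnorm_ge0//.
have -> : (Q - P) *m v = Q *m (1%:M - P) *m v - (1%:M - Q) *m P *m v.
  rewrite -mulmxBl; congr (_ *m _).
  rewrite mulmxBr mulmxBl mulmx1 mul1mx.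
  by rewrite opprB addrA subrK.
have orth (x y : 'cV[R]_m) : ip (Q *m x) ((1%:M - Q) *m y) = 0.
  by rewrite ipMl sQ mulmxA mulmxBr mulmx1 QQ subrr mul0mx ipC ip0l.
have pyth (x : 'cV[R]_m) : fnorm x ^+ 2 = fnorm (P *m x) ^+ 2 + fnorm ((1%:M - P) *m x) ^+ 2.
  have o : ip (P *m x) ((1%:M - P) *m x) = 0.
    by rewrite ipMl sP mulmxA mulmxBr mulmx1 PP subrr mul0mx ipC ip0l.
  rewrite -[x in LHS](_ : P *m x + (1%:M - P) *m x = x); last first.
    by rewrite -mulmxDl addrC subrK mul1mx.
  by rewrite !sqr_fnorm ipDl !ipDr (ipC ((1%:M - P) *m x)) o add0r addr0.
rewrite sqr_fnorm ipDl !ipDr !ipNl !ipNr -!mulmxA orth (ipC ((1%:M - Q) *m _)) orth.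
rewrite !oppr0 addr0 add0r opprK -!sqr_fnorm exprMn (pyth v) mulrDr addrC.
(* A second copy of the projector is inserted so that the bound involves only the component of
   [v]. *)
have h1 : fnorm (Q *m ((1%:M - P) *m v)) <= s * fnorm ((1%:M - P) *m v).
  by rewrite -{1}P'P' -mulmxA mulmxA; exact: QP.
have h2 : fnorm ((1%:M - Q) *m (P *m v)) <= s * fnorm (P *m v).
  by rewrite -{1}PP -mulmxA mulmxA; exact: Q'P.
by rewrite -!exprMn lerD// ler_sqr ?nnegrE ?mulr_ge0 ?fnorm_ge0.
Qed.

(** [A] expands the leading eigenspace by at least [a]. Positivity of [B] turns the upper bound [b]
    on its trailing eigenvalues into a norm bound, as the Sylvester estimate requires. *)
Lemma spec_proj_gap A B W U lam theta n (e a b : R) : (0 < n)%N -> (n < m)%N ->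
  eigen_decomposition A W lam -> eigen_decomposition B U theta ->
  psd B -> 0 <= e -> opbound (B - A) e -> a <= lam n -> theta n.+1 <= b -> b < a ->
  opbound (spec_fun W (fun i => (i < n)%:R) *m
           (1%:M - spec_fun U (fun i => (i < n)%:R))) (e / (a - b)).
Proof.
move=> n0 nm dA dB pB e0 he alam thetab ba.
have [WW _ lam_le] := dA; have [UU _ theta_le] := dB.
have theta_ge0 i : (i < m)%N -> 0 <= theta i.+1.
  by move: pB; rewrite (eigen_decompositionE dB) => /(spec_fun_psd UU); apply.
have b0 : 0 <= b by exact: le_trans (theta_ge0 _ nm) thetab.
rewrite -(spec_fun1 UU) spec_funB.
have op1 V (f : nat -> R) : V^T *m V = 1%:M -> (forall i, `|f i| <= 1) ->
    opbound (spec_fun V f) 1.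
  move=> VV f1 v; rewrite -[1]ger0_norm// -(fnorm_spec_cst VV).
  by apply: fnorm_spec_fun_le => // i _; rewrite [leRHS]ger0_norm.
apply: (@sylvester_bound _ _ A B) => //.
- rewrite (eigen_decompositionE dA) !spec_funM//.
  by congr spec_fun; apply/funext => i; rewrite mulrC.
- rewrite (eigen_decompositionE dB) !spec_funM//.
  by congr spec_fun; apply/funext => i; rewrite mulrC.
- rewrite spec_funM//; congr spec_fun; apply/funext => i.
  by case: (_ < _)%N => /=; rewrite ?subrr ?mulr0// subr0 mulr1.
- move=> v; rewrite -[a]ger0_norm ?(le_trans b0 (ltW ba))// -(fnorm_spec_cst WW).
  rewrite mulmxA (eigen_decompositionE dA) !spec_funM//.
  apply: fnorm_spec_fun_le => // i im; rewrite !normrM.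
  have [i_n|] := ltnP i n; last by rewrite normr0 !mulr0.
  rewrite ler_wpM2r//; apply: le_trans (ler_norm _).
  by rewrite ger0_norm ?(le_trans b0 (ltW ba))//; apply: le_trans alam (lam_le _ _ _ _ _) => //; exact: ltnW.
- move=> v; rewrite -[b]ger0_norm// -(fnorm_spec_cst UU).
  rewrite (eigen_decompositionE dB) spec_funM//.
  apply: fnorm_spec_fun_le => // i im; rewrite normrM.
  have [i_n|ni] := ltnP i n; first by rewrite subrr normr0 mulr0.
  rewrite subr0 normr1 mulr1 !ger0_norm// ?theta_ge0//.
  by apply: le_trans thetab; exact: theta_le.
- by apply: op1 => // i; case: (_ < _)%N; rewrite ?normr1// normr0.
- by apply: op1 => // i; case: (_ < _)%N; rewrite ?subrr ?subr0 ?normr1// normr0.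
Qed.

(** Both mixed products of projectors are bounded separately. Each compares an eigenvalue of one
    matrix with one of the other, and Weyl's inequality costs one [e] of the gap in either case. *)
Lemma davis_kahan A B W U lam theta n (nm : (n < m)%N) (e : R) : (0 < n)%N ->
  eigen_decomposition A W lam -> eigen_decomposition B U theta ->
  psd A -> psd B -> 0 <= e -> opbound (B - A) e -> e < lam n - lam n.+1 ->
  range_dist (first_cols (ltnW nm) U) (first_cols (ltnW nm) W)
    <= e / (lam n - lam n.+1 - e).
Proof.
move=> n0 dA dB pA pB e0 he gap.
have [WW _ _] := dA; have [UU _ _] := dB.
have he' : opbound (A - B) e by rewrite -opprB; exact: opboundN.
have s0 : 0 <= e / (lam n - lam n.+1 - e) by rewrite divr_ge0// subr_ge0 ltW.
have idem V : V^T *m V = 1%:M ->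
    spec_fun V (fun i => (i < n)%:R : R) *m spec_fun V (fun i => (i < n)%:R) =
    spec_fun V (fun i => (i < n)%:R).
  move=> VV; rewrite spec_funM//; congr spec_fun; apply/funext => i.
  by case: (_ < _)%N; rewrite ?mulr1// mulr0.
rewrite /range_dist !first_cols_spec; apply: specnorm_le => //.
apply: opbound_projector_diff; rewrite ?spec_fun_tr ?idem//.
  rewrite (_ : _ - e = lam n - (lam n.+1 + e)); last by ring.
  by apply: (spec_proj_gap n0 nm dA dB) => //; [exact: weyl dA dB he nm|lra].
rewrite (_ : _ - e = (lam n - e) - lam n.+1); last by ring.
apply: (spec_proj_gap n0 nm dB dA) => //; last by lra.
(* Weyl with the matrices interchanged, [lam n <= theta n + e]; its index is shifted by one, hence
   the case analysis. *)
by case: n n0 nm {gap s0 idem} => // n _ nm; rewrite lerBlDr; exact: weyl dB dA he' (ltnW nm).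
Qed.

End eigenspaces.

(** * Bounded measurable functions and their expectations *)

Section bounded_measurable.
Context {R : realType} {d} {T : measurableType d} (D : set T).

(** Measurability is global but boundedness only on [D]: a polynomial in the matrix entries is
    unbounded on the whole space and bounded where the samples take their values. *)
Definition bmeas (f : T -> R) : Prop :=
  measurable_fun setT f /\ exists M, forall x, D x -> `|f x| <= M.

Definition mbmeas m n (F : T -> 'M[R]_(m, n)) : Prop :=
  forall i j, bmeas (fun x => F x i j).

Lemma bmeas_cst (c : R) : bmeas (fun=> c).
Proof. by split; [exact: measurable_cst|exists `|c|]. Qed.

Lemma bmeasD f g : bmeas f -> bmeas g -> bmeas (fun x => f x + g x).
Proof.
move=> [mf [M fM]] [mg [K gK]]; split; first exact: measurable_funD.
by exists (M + K) => x Dx; apply: le_trans (ler_normD _ _) _; rewrite lerD ?fM ?gK.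
Qed.

Lemma bmeasM f g : bmeas f -> bmeas g -> bmeas (fun x => f x * g x).
Proof.
move=> [mf [M fM]] [mg [K gK]]; split; first exact: measurable_funM.
by exists (M * K) => x Dx; rewrite normrM ler_pM ?fM ?gK.
Qed.

Lemma bmeas_sum I (r : seq I) (F : I -> T -> R) :
  (forall i, bmeas (F i)) -> bmeas (fun x => \sum_(i <- r) F i x).
Proof.
move=> h; elim: r => [|i r IH].
  by under eq_fun do rewrite big_nil; exact: bmeas_cst.
by under eq_fun do rewrite big_cons; exact: bmeasD.
Qed.

Lemma mbmeas_cst m n (C : 'M[R]_(m, n)) : mbmeas (fun=> C).
Proof. by move=> i j; exact: bmeas_cst. Qed.

Lemma mbmeasD m n (F G : T -> 'M[R]_(m, n)) :
  mbmeas F -> mbmeas G -> mbmeas (fun x => F x + G x).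
Proof. by move=> hF hG i j; under eq_fun do rewrite mxE; exact: bmeasD. Qed.

Lemma mbmeasN m n (F : T -> 'M[R]_(m, n)) : mbmeas F -> mbmeas (fun x => - F x).
Proof.
move=> hF i j; under eq_fun do rewrite mxE -mulN1r.
by apply: bmeasM => //; exact: bmeas_cst.
Qed.

Lemma mbmeas_mulmx m n p (F : T -> 'M[R]_(m, n)) (G : T -> 'M[R]_(n, p)) :
  mbmeas F -> mbmeas G -> mbmeas (fun x => F x *m G x).
Proof.
move=> hF hG i j; under eq_fun do rewrite mxE.
by apply: bmeas_sum => k; exact: bmeasM.
Qed.

Lemma mbmeas_sum m n I (r : seq I) (F : I -> T -> 'M[R]_(m, n)) :
  (forall i, mbmeas (F i)) -> mbmeas (fun x => \sum_(i <- r) F i x).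
Proof.
by move=> h i j; under eq_fun do rewrite summxE; apply: bmeas_sum => k; exact: h.
Qed.

Lemma mbmeasX m (F : T -> 'M[R]_m) k : mbmeas F -> mbmeas (fun x => F x ^+ k).
Proof.
move=> hF; elim: k => [|k IH]; first exact: mbmeas_cst.
by under eq_fun do rewrite exprS; exact: mbmeas_mulmx.
Qed.

Lemma bmeas_ip m n (F G : T -> 'M[R]_(m, n)) :
  mbmeas F -> mbmeas G -> bmeas (fun x => ip (F x) (G x)).
Proof.
move=> hF hG; under eq_fun do rewrite ipE.
by apply: bmeas_sum => j; apply: bmeas_sum => i; exact: bmeasM.
Qed.

Lemma bmeas_tr m (F : T -> 'M[R]_m) : mbmeas F -> bmeas (fun x => \tr (F x)).
Proof. by move=> hF; apply: bmeas_sum => i; exact: hF. Qed.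

End bounded_measurable.

Lemma bmeas_comp (R : realType) d d' (T : measurableType d) (S : measurableType d')
    (D : set T) (D' : set S) (f : T -> R) (g : S -> T) :
  bmeas D f -> measurable_fun setT g -> (forall s, D' s -> D (g s)) ->
  bmeas D' (fun s => f (g s)).
Proof.
move=> [mf [M fM]] mg DD; split; first exact: measurableT_comp mf mg.
by exists M => s /DD /fM.
Qed.

Section expectation.
Context {R : realType} {d} {T : measurableType d} (P : probability T R).
Local Notation "''E' f" := (\int[P]_x f x) (at level 10, f at level 8).
Local Notation bm := (bmeas setT).

Lemma bmeas_integrable (f : T -> R) : bm f -> P.-integrable setT (EFin \o f).
Proof.
move=> [mf [M fM]]; apply: measurable_bounded_integrable => //.
  by rewrite (le_lt_trans (probability_le1 P _))// ltry.
exists M; split; first exact: num_real.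
by move=> x Mx y _; apply: le_trans (ltW Mx); exact: fM.
Qed.

Lemma expD (f g : T -> R) : bm f -> bm g -> 'E (fun x => f x + g x) = 'E f + 'E g.
Proof. by move=> hf hg; rewrite RintegralD//; exact: bmeas_integrable. Qed.

Lemma expZ (a : R) (f : T -> R) : bm f -> 'E (fun x => a * f x) = a * 'E f.
Proof. by move=> hf; rewrite RintegralZl//; exact: bmeas_integrable. Qed.

Lemma exp_le (f g : T -> R) : bm f -> bm g -> (forall x, f x <= g x) -> 'E f <= 'E g.
Proof. by move=> hf hg fg; apply: le_Rintegral => //; exact: bmeas_integrable. Qed.

Lemma exp_cst (c : R) : 'E (fun=> c) = c.
Proof.
rewrite Rintegral_cst// [X in _ * fine X](_ : _ = 1%E) ?mulr1//.
exact: probability_setT.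
Qed.

Lemma exp_sum I (r : seq I) (F : I -> T -> R) : (forall i, bm (F i)) ->
  'E (fun x => \sum_(i <- r) F i x) = \sum_(i <- r) 'E (F i).
Proof.
move=> h; elim: r => [|i r IH].
  by under eq_Rintegral do rewrite big_nil; rewrite exp_cst big_nil.
under eq_Rintegral do rewrite big_cons.
by rewrite expD// ?IH ?big_cons//; exact: bmeas_sum.
Qed.

Lemma exp_markov (f : T -> R) (t : R) : bm f -> (forall x, 0 <= f x) ->
  ((t * fine (P [set x | t < f x]))%R <= 'E f)%R.
Proof.
move=> hf f0; have mE : measurable [set x | t < f x].
  rewrite -[X in measurable X]setTI; rewrite [X in measurable X](_ : _ =
    setT `&` f @^-1` `]t, +oo[%classic); first exact: (hf.1 measurableT).
  by apply/seteqP; split => x /=; rewrite in_itv/= andbT.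
have [t0|t0] := leP t 0.
  apply: (@le_trans _ _ 0); first by rewrite mulr_le0_ge0// fine_ge0.
  exact: Rintegral_ge0.
rewrite -[fine _](_ : 'E (\1_[set x | t < f x]) = _); last first.
  by rewrite /Rintegral integral_indic// setIT.
have h1 : bm (\1_[set x | t < f x]).
  split; first exact: measurable_indic.
  by exists 1 => x _; rewrite indicE; case: (_ \in _); rewrite ?normr1// normr0.
rewrite -expZ//; apply: exp_le => //.
  by apply: bmeasM => //; exact: bmeas_cst.
move=> x; rewrite indicE; case: (boolP (_ \in _)); rewrite ?mulr0 ?mulr1//.
by rewrite inE /= => /ltW.
Qed.

End expectation.

Section product_expectation.
Context {R : realType} {d} {T : measurableType d} (P : probability T R).

Lemma exp_fubini (f : T * T -> R) : bmeas setT f ->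
  \int[(P \x P)%E]_z f z = \int[P]_x \int[P]_y f (x, y).
Proof.
move=> hf; have intf := bmeas_integrable (P \x P)%E hf.
rewrite /Rintegral; congr fine.
rewrite -(integral12_prod_meas1 (f := EFin \o f))//; apply: eq_integral => x _.
rewrite /fubini_F fineK//; apply: integrable_fin_num => //.
apply: bmeas_integrable; exact: bmeas_comp hf _ _.
Qed.

Lemma exp_fst (f : T -> R) : bmeas setT f -> \int[(P \x P)%E]_z f z.1 = \int[P]_x f x.
Proof.
move=> hf; rewrite exp_fubini; last by apply: bmeas_comp hf _ _ => //; exact: measurable_fst.
by apply: eq_Rintegral => x _; exact: (exp_cst P (f x)).
Qed.

End product_expectation.

(** * Exchanging one observation for an independent copy *)

Section matrix_rectangles.
Context {d} {T : measurableType d} {m n : nat}.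

Definition rectangle (B : 'I_m -> 'I_n -> set T) : set 'M[T]_(m, n) :=
  [set z | forall i j, B i j (z i j)].

Definition rectangles : set (set 'M[T]_(m, n)) :=
  [set A | exists2 B, (forall i j, measurable (B i j)) & A = rectangle B].

Lemma rectangleE B :
  rectangle B = \bigcap_i \bigcap_j ((fun z : 'M[T]_(m, n) => z i j) @^-1` B i j).
Proof. by apply/seteqP; split => z /= h i; [move=> _ j _|move=> j]; apply: h. Qed.

Lemma measurable_rectangle B : (forall i j, measurable (B i j)) ->
  measurable (rectangle B).
Proof.
move=> mB; rewrite rectangleE; apply: fin_bigcap_measurable => // i _.
apply: fin_bigcap_measurable => // j _.
by rewrite -[X in measurable X]setTI; exact: measurable_mx_coord.
Qed.

Lemma rectangles_setI : setI_closed rectangles.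
Proof.
move=> _ _ [B mB ->] [B' mB' ->]; exists (fun i j => B i j `&` B' i j).
  by move=> i j; exact: measurableI.
by apply/seteqP; split => z /= => [[h h'] i j|h]; [split|split => i j; have [] := h i j].
Qed.

Lemma measurable_rectangles (A : set 'M[T]_(m, n)) : measurable A -> <<s rectangles >> A.
Proof.
apply: sub_sigma_algebra2 => _ [i [j [B mB ->]]].
exists (fun i' j' => if (i' == i) && (j' == j) then B else setT).
  by move=> i' j'; case: ifP.
apply/seteqP; split => z /= h; last by have := h i j; rewrite !eqxx.
by move=> i' j'; case: ifP => // /andP[/eqP-> /eqP->].
Qed.

(** The laws of [Z] and [Z'] are finite and agree on rectangles, a generating class closed under
    intersection, so they coincide. *)
Lemma eq_exp_rectangles (R : realType) d' (S : measurableType d') (P : probability S R)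
    (Z Z' : S -> 'M[T]_(m, n)) (D : set 'M[T]_(m, n)) (F : 'M[T]_(m, n) -> R) :
  measurable_fun setT Z -> measurable_fun setT Z' ->
  (forall B, (forall i j, measurable (B i j)) ->
    P (Z @^-1` rectangle B) = P (Z' @^-1` rectangle B)) ->
  bmeas D F -> (forall s, D (Z s)) -> (forall s, D (Z' s)) ->
  \int[P]_s F (Z s) = \int[P]_s F (Z' s).
Proof.
move=> mZ mZ' ZZ' hF DZ DZ'; rewrite /Rintegral; congr fine.
have int V : measurable_fun setT V -> (forall s, D (V s)) ->
    P.-integrable setT ((EFin \o F) \o V).
  by move=> mV DV; apply: (@bmeas_integrable _ _ _ P (F \o V)); exact: bmeas_comp hF mV _.
have mF : measurable_fun setT (EFin \o F) by apply/measurable_EFinP; exact: hF.1.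
have push V (mV : measurable_fun setT V) : (forall s, D (V s)) ->
    (\int[P]_s (F (V s))%:E = \int[pushforward P V]_z (F z)%:E)%E.
  by move=> DV; rewrite (integral_pushforward mV mF)//; exact: int.
rewrite (push _ mZ)// (push _ mZ')//; apply: eq_measure_integral => A mA _.
apply: (@g_sigma_algebra_measure_unique _ _ _ rectangles _ (fun=> setT)) => //.
- by move=> _ [B mB ->]; exact: measurable_rectangle.
- by move=> _; exists (fun _ _ => setT) => //; apply/seteqP; split.
- by rewrite bigcup_const//; exists 0%N.
- exact: rectangles_setI.
- by move=> _ [B mB ->]; exact: ZZ'.
- by move=> _; rewrite /= /pushforward preimage_setT (le_lt_trans (probability_le1 P _))// ltry.
- exact: measurable_rectangles.
Qed.

End matrix_rectangles.

Section exchange.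
Context {R : realType} {d d'} {S : measurableType d} {T : measurableType d'}.
Context (P : probability S R) {N : nat} (Y : 'I_N -> S -> T).
Hypothesis mY : forall j, measurable_fun setT (Y j).
Hypothesis Y_indep : forall B : 'I_N -> set T, (forall j, measurable (B j)) ->
  P (\bigcap_j (Y j @^-1` B j)) = (\prod_j P (Y j @^-1` B j))%E.

(* The two columns are two independent copies of the sample [Y]. *)
Definition two_copies (w : S * S) : 'M[T]_(N, 2) :=
  \matrix_(j, b) Y j (if b == 0 then w.1 else w.2).

Definition exchange (i : 'I_N) (z : 'M[T]_(N, 2)) : 'M[T]_(N, 2) :=
  \matrix_(j, b) z j (if j == i then rev_ord b else b).

Lemma measurable_two_copies : measurable_fun setT two_copies.
Proof.
apply: measurable_fun_mxP => j b; under eq_fun do rewrite mxE.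
by case: (b == 0); apply: measurableT_comp.
Qed.

Lemma measurable_exchange i : measurable_fun setT (exchange i).
Proof.
apply: measurable_fun_mxP => j b; under eq_fun do rewrite mxE.
exact: measurable_mx_coord.
Qed.

Lemma prob_two_copies (B : 'I_N -> 'I_2 -> set T) :
  (forall j b, measurable (B j b)) ->
  ((P \x P) (two_copies @^-1` rectangle B) =
   \prod_j (P (Y j @^-1` B j 0%R) * P (Y j @^-1` B j 1%R)))%E.
Proof.
move=> mB.
have -> : two_copies @^-1` rectangle B =
    (\bigcap_j (Y j @^-1` B j 0)) `*` (\bigcap_j (Y j @^-1` B j 1)).
  apply/seteqP; split => w /=.
    by move=> h; split => j _; [have := h j 0|have := h j 1]; rewrite mxE.
  move=> [h0 h1] j b; rewrite mxE.
  case: b => -[|[|//]] b2 /=; first by have := h0 j I; congr (B j _ _); exact: val_inj.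
  by have := h1 j I; congr (B j _ _); exact: val_inj.
have mI b : measurable (\bigcap_j (Y j @^-1` B j b)).
  apply: fin_bigcap_measurable => // j _.
  by rewrite -[X in measurable X]setTI; exact: mY.
apply: etrans (product_measure1E P P (mI 0) (mI 1)) _.
by rewrite big_split; congr (_ * _)%E; exact: Y_indep.
Qed.

(** The probability of a rectangle is a product over the rows of factors symmetric in the two
    columns, so swapping the entries of one row preserves the law. *)
Lemma exp_exchange (i : 'I_N) (D : set 'M[T]_(N, 2)) (F : 'M[T]_(N, 2) -> R) :
  bmeas D F -> (forall w, D (two_copies w)) ->
  (forall w, D (exchange i (two_copies w))) ->
  \int[(P \x P)%E]_w F (two_copies w) = \int[(P \x P)%E]_w F (exchange i (two_copies w)).
Proof.
move=> hF D1 D2; apply: eq_exp_rectangles hF D1 D2.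
- exact: measurable_two_copies.
- exact: measurableT_comp (measurable_exchange i) measurable_two_copies.
move=> B mB.
have -> : (fun w => exchange i (two_copies w)) @^-1` rectangle B =
    two_copies @^-1` rectangle (fun j b => B j (if j == i then rev_ord b else b)).
  apply/seteqP; split => w /= h j b.
    by have := h j (if j == i then rev_ord b else b); rewrite mxE; case: eqP => // _; rewrite rev_ordK.
  by rewrite mxE; have := h j (if j == i then rev_ord b else b); case: eqP => // _; rewrite rev_ordK.
apply: etrans (prob_two_copies mB) _; apply: esym.
apply: etrans (prob_two_copies _) _ => //; apply: eq_bigr => j _; case: (j == i) => //.
by rewrite muleC; congr (P (_ @^-1` B j _) * P (_ @^-1` B j _))%E; exact: val_inj.
Qed.

End exchange.

(** * Moments of a sum of independent positive semidefinite matrices *)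

Section matrix_moments.
Context {R : realType} {d} {S : measurableType d} (P : probability S R).
Context {m N : nat} (Y : 'I_N -> S -> 'M[R]_m) (C : 'M[R]_m) (k lam K : R).
Hypothesis mY : forall j, measurable_fun setT (Y j).
Hypothesis Y_indep : forall B : 'I_N -> set 'M[R]_m, (forall j, measurable (B j)) ->
  P (\bigcap_j (Y j @^-1` B j)) = (\prod_j P (Y j @^-1` B j))%E.
Hypothesis Y_sym : forall j w, (Y j w)^T = Y j w.
Hypothesis Y_sqr : forall j w, psd (k *: Y j w - Y j w *m Y j w).
Hypothesis Y_bound : forall j w a b, `|Y j w a b| <= K.
Hypothesis Y_mean : forall j a b, \int[P]_w Y j w a b = C a b.
Hypothesis C_sym : C^T = C.
Hypothesis C_le : forall v : 'cV[R]_m, ip v (C *m v) <= lam * ip v v.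
Hypothesis k_ge0 : 0 <= k.
Hypothesis lam_ge0 : 0 <= lam.

Definition centered_sum (w : S) : 'M[R]_m := \sum_j (Y j w - C).

Local Notation PP := ((P \x P)%E).

Local Notation T := 'M['M[R]_m]_(N, 2).
Let D : set T := [set z : T | forall j b a c, `|z j b a c| <= K].
Let Sz (z : T) : 'M[R]_m := \sum_j (z j 0 - C).
Let gap i (z : T) : 'M[R]_m := z i 0 - z i 1.

Let mbmeas_coord j b : mbmeas D (fun z => z j b).
Proof.
move=> a c; split; last by exists K => z; apply.
have mj : measurable_fun setT (fun z : T => z j b) by exact: measurable_mx_coord.
exact: measurableT_comp (measurable_mx_coord a c) mj.
Qed.

Let mbmeas_Sz : mbmeas D Sz.
Proof.
apply: mbmeas_sum => j; apply: mbmeasD; first exact: mbmeas_coord.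
exact: mbmeas_cst.
Qed.

Let mbmeas_gap i : mbmeas D (gap i).
Proof. by apply: mbmeasD; [|apply: mbmeasN]; exact: mbmeas_coord. Qed.

Let D_copies w : D (two_copies Y w).
Proof. by move=> j b a c; rewrite mxE. Qed.

Let D_exchange i w : D (exchange i (two_copies Y w)).
Proof. by move=> j b a c; rewrite !mxE. Qed.

Let mbmeas_Y j : mbmeas setT (Y j).
Proof.
move=> a b; split; last by exists K.
exact: measurableT_comp (measurable_mx_coord a b) (mY j).
Qed.

Lemma mbmeas_centered_sum : mbmeas setT centered_sum.
Proof. by apply: mbmeas_sum => j; apply: mbmeasD => //; exact: mbmeas_cst. Qed.

Lemma centered_sum_sym w : (centered_sum w)^T = centered_sum w.
Proof.
rewrite /centered_sum trmx_sum; apply: eq_bigr => j _.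
by rewrite trmxB Y_sym C_sym.
Qed.

Let mbmeas_fst n p (F : S -> 'M[R]_(n, p)) :
  mbmeas setT F -> mbmeas setT (fun w : S * S => F w.1).
Proof. by move=> hF a b; apply: bmeas_comp (hF a b) _ _ => //; exact: measurable_fst. Qed.

Let mbmeas_snd n p (F : S -> 'M[R]_(n, p)) :
  mbmeas setT F -> mbmeas setT (fun w : S * S => F w.2).
Proof. by move=> hF a b; apply: bmeas_comp (hF a b) _ _ => //; exact: measurable_snd. Qed.

(** By Fubini the copy is integrated first, with [Q] frozen; as it occurs linearly, only its mean
    remains. *)
Lemma exp_copy j (Q : S -> 'M[R]_m) : mbmeas setT Q ->
  \int[PP]_w ip (Y j w.2) (Q w.1) = \int[P]_w ip C (Q w).
Proof.
move=> hQ; rewrite exp_fubini; last first.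
  by apply: bmeas_ip; [exact: mbmeas_snd|exact: mbmeas_fst].
apply: eq_Rintegral => w _ /=.
have bYQ a b : bmeas setT (fun y => Y j y a b * Q w a b).
  by apply: bmeasM; [exact: mbmeas_Y|exact: bmeas_cst].
rewrite ipE; under eq_Rintegral do rewrite ipE.
rewrite exp_sum => [|b]; last by apply: bmeas_sum => a.
apply: eq_bigr => b _; rewrite exp_sum//; apply: eq_bigr => a _.
rewrite -(Y_mean j); under eq_Rintegral do rewrite mulrC.
by rewrite expZ 1?mulrC//; exact: mbmeas_Y.
Qed.

Let Sz_copies w : Sz (two_copies Y w) = centered_sum w.1.
Proof. by apply: eq_bigr => j _; rewrite mxE. Qed.

Let gap_copies i w : gap i (two_copies Y w) = Y i w.1 - Y i w.2.
Proof. by rewrite /gap !mxE. Qed.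

Let gap_exchange i w : gap i (exchange i (two_copies Y w)) = - gap i (two_copies Y w).
Proof.
rewrite /gap opprB [exchange _ _ _ 0]mxE [exchange _ _ _ 1]mxE eqxx.
by congr (two_copies Y w i _ - two_copies Y w i _); exact: val_inj.
Qed.

Let Sz_exchange i w :
  Sz (two_copies Y w) - Sz (exchange i (two_copies Y w)) = gap i (two_copies Y w).
Proof.
rewrite /Sz -sumrB (bigD1 i)//= big1 => [|j ji].
  rewrite addr0 opprB addrA subrK [exchange _ _ _ _]mxE eqxx /gap.
  by congr (_ - two_copies Y w i _); exact: val_inj.
by rewrite [exchange _ _ _ _]mxE (negbTE ji) subrr.
Qed.

Let Sz_exchange_sym i w :
  (Sz (exchange i (two_copies Y w)))^T = Sz (exchange i (two_copies Y w)).
Proof.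
rewrite /Sz trmx_sum; apply: eq_bigr => j _.
by rewrite trmxB C_sym ![exchange _ _ _ _]mxE ![two_copies _ _ _ _]mxE Y_sym.
Qed.

Let moment q : R := \int[P]_w \tr (centered_sum w ^+ q).

Let bmeas_moment q : bmeas setT (fun w => \tr (centered_sum w ^+ q)).
Proof. by apply: bmeas_tr; apply: mbmeasX; exact: mbmeas_centered_sum. Qed.

Lemma exp_term i q :
  \int[P]_w ip (Y i w - C) (centered_sum w ^+ q.*2.+1) <=
  q.*2.+1%:R * k * \int[P]_w ip (centered_sum w ^+ q) ((Y i w + C) *m centered_sum w ^+ q).
Proof.
pose F1 z := ip (gap i z) (Sz z ^+ q.*2.+1).
pose G z := gap i z *m Sz z ^+ q.
pose F2 z := ip (G z) (G z).
have hF1 : bmeas D F1 by apply: bmeas_ip => //; exact: mbmeasX.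
have hG : mbmeas D G by apply: mbmeas_mulmx => //; exact: mbmeasX.
have hF2 : bmeas D F2 by exact: bmeas_ip.
have cp (F : T -> R) : bmeas D F -> bmeas setT (fun w => F (two_copies Y w)).
  by move=> hF; apply: bmeas_comp hF _ _ => //; exact: measurable_two_copies.
have ex (F : T -> R) : bmeas D F -> bmeas setT (fun w => F (exchange i (two_copies Y w))).
  move=> hF; apply: bmeas_comp hF _ _ => //.
  exact: measurableT_comp (measurable_exchange i) (measurable_two_copies mY).
have hS r : mbmeas setT (fun w => centered_sum w ^+ r).
  by apply: mbmeasX; exact: mbmeas_centered_sum.
have c1 := cp _ hF1; have c2 := cp _ hF2; have e1 := ex _ hF1; have e2 := ex _ hF2.
have eqF (F : T -> R) : bmeas D F ->
    \int[PP]_w F (two_copies Y w) = \int[PP]_w F (exchange i (two_copies Y w)).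
  by move=> hF; apply: exp_exchange hF _ _.
(* [C] is the mean of the copy, so [Y i - C] may be replaced by the difference of the observation
   and its copy. *)
have LHS : \int[P]_w ip (Y i w - C) (centered_sum w ^+ q.*2.+1) =
    \int[PP]_w F1 (two_copies Y w).
  rewrite /F1; under [RHS]eq_Rintegral do rewrite Sz_copies gap_copies ipDl ipNl -mulN1r.
  rewrite [RHS]expD; last 2 first.
  - by apply: bmeas_ip; [apply: (mbmeas_fst (mbmeas_Y i))|apply: (mbmeas_fst (hS _))].
  - apply: bmeasM; first exact: bmeas_cst.
    by apply: bmeas_ip; [apply: (mbmeas_snd (mbmeas_Y i))|apply: (mbmeas_fst (hS _))].
  rewrite expZ; last first.
    by apply: bmeas_ip; [apply: (mbmeas_snd (mbmeas_Y i))|apply: (mbmeas_fst (hS _))].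
  rewrite (exp_copy i (hS _)) (exp_fst P (f := fun w => ip (Y i w) (centered_sum w ^+ q.*2.+1))); last first.
    exact: bmeas_ip.
  have hC : bmeas setT (fun w => ip C (centered_sum w ^+ q.*2.+1)).
    by apply: bmeas_ip => //; exact: mbmeas_cst.
  rewrite -expZ// -expD; last 2 first.
  - exact: bmeas_ip.
  - by apply: bmeasM => //; exact: bmeas_cst.
  by apply: eq_Rintegral => w _; rewrite ipDl ipNl mulN1r.
(* The exchange reverses the sign of [gap]. Averaging over it gives the integrand of [ip_subX],
   whose two squares on the right have equal expectations. *)
have step1 : 2 * \int[PP]_w F1 (two_copies Y w) <=
    q.*2.+1%:R * \int[PP]_w F2 (two_copies Y w).
  have -> : 2 * \int[PP]_w F1 (two_copies Y w) =
      \int[PP]_w (F1 (two_copies Y w) + F1 (exchange i (two_copies Y w))).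
    by rewrite (expD _ c1 e1) -(eqF F1 hF1) mulr_natl mulr2n.
  have -> : q.*2.+1%:R * \int[PP]_w F2 (two_copies Y w) =
      \int[PP]_w (q.*2.+1%:R / 2 *
        (F2 (two_copies Y w) + F2 (exchange i (two_copies Y w)))).
    have bD := bmeasD c2 e2.
    rewrite (expZ _ _ bD) (expD _ c2 e2) -(eqF F2 hF2).
    by move: (Rintegral _ _ _) => x; field.
  apply: exp_le.
  - by apply: bmeasD; [exact: cp|exact: ex].
  - apply: bmeasM; first exact: bmeas_cst.
    by apply: bmeasD; [exact: cp|exact: ex].
  move=> w; rewrite /F1 /F2 /G !gap_exchange ipNl !mulNmx ipNl ipNr opprK -ipNr -ipDr.
  have sA : (Sz (two_copies Y w))^T = Sz (two_copies Y w).
    by rewrite Sz_copies centered_sum_sym.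
  have := ip_subX q sA (Sz_exchange_sym i w); rewrite Sz_exchange.
  by rewrite mulrAC ler_pdivlMr// [_ * 2]mulrC.
have step2 : \int[PP]_w F2 (two_copies Y w) <=
    2 * k * \int[P]_w ip (centered_sum w ^+ q) ((Y i w + C) *m centered_sum w ^+ q).
  have hH : bmeas setT (fun w => ip (centered_sum w ^+ q) ((Y i w + C) *m centered_sum w ^+ q)).
    apply: bmeas_ip => //; apply: mbmeas_mulmx => //; apply: mbmeasD => //.
    exact: mbmeas_cst.
  have hH1 : bmeas setT (fun w => ip (centered_sum w ^+ q) (Y i w *m centered_sum w ^+ q)).
    by apply: bmeas_ip => //; exact: mbmeas_mulmx.
  have hH2 : bmeas setT (fun w : S * S =>
      ip (centered_sum w.1 ^+ q) (Y i w.1 *m centered_sum w.1 ^+ q)).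
    by apply: bmeas_comp hH1 _ _ => //; exact: measurable_fst.
  (* Collects both powers on one side, so that the copy is paired with a function of the first
     sample alone, as in [exp_copy]. *)
  pose Q w := centered_sum w ^+ q *m (centered_sum w ^+ q)^T.
  have hQ : mbmeas setT Q.
    apply: mbmeas_mulmx => // a b; under eq_fun do rewrite mxE; exact: hS.
  have hY2 : bmeas setT (fun w : S * S => ip (Y i w.2) (Q w.1)).
    by apply: bmeas_ip; [exact: mbmeas_snd|exact: mbmeas_fst].
  have hC : bmeas setT (fun w => ip C (Q w)).
    by apply: bmeas_ip => //; exact: mbmeas_cst.
  have -> : \int[P]_w ip (centered_sum w ^+ q) ((Y i w + C) *m centered_sum w ^+ q) =
      \int[PP]_w (ip (centered_sum w.1 ^+ q) (Y i w.1 *m centered_sum w.1 ^+ q) +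
                  ip (Y i w.2) (Q w.1)).
    rewrite expD// exp_copy// (exp_fst P hH1) -expD//.
    by apply: eq_Rintegral => w _; rewrite mulmxDl ipDr [ip _ (C *m _)]ipC ipMr.
  rewrite -expZ; last exact: bmeasD.
  apply: exp_le; first exact: cp.
    apply: bmeasM; first exact: bmeas_cst.
    exact: bmeasD.
  move=> w; rewrite /F2 /G gap_copies Sz_copies.
  apply: le_trans (ip_sub_le _ _ _ (Y_sqr i w.1) (Y_sqr i w.2)) _ => //.
  by rewrite mulmxDl ipDr /Q -[ip (Y i w.2) _]ipMr [ip (Y i w.2 *m _) _]ipC.
rewrite LHS -(ler_pM2l (ltr0n R 2)); apply: le_trans step1 _.
apply: le_trans (ler_wpM2l (ler0n _ _) step2) _.
by move: (Rintegral _ _ _) => x; rewrite (_ : _ * (2 * k * x) = 2 * (q.*2.+1%:R * k * x)) //; ring.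
Qed.

Lemma moment_step q a : a = q.*2.+1%:R * k ->
  moment q.+1.*2 <= (a ^+ 2 + 4 * a * N%:R * lam) * moment q.*2.
Proof.
move=> aE.
have hS r : mbmeas setT (fun w => centered_sum w ^+ r).
  by apply: mbmeasX; exact: mbmeas_centered_sum.
have split_sum w : \tr (centered_sum w ^+ q.+1.*2) =
    \sum_i ip (Y i w - C) (centered_sum w ^+ q.*2.+1).
  rewrite doubleS exprS -{1}centered_sum_sym -/(ip _ _) {1}/centered_sum.
  by rewrite ipC ip_sumr; apply: eq_bigr => i _; rewrite ipC.
have hC : mbmeas (R := R) (T := S) setT (fun=> C) by exact: mbmeas_cst.
have E1 : moment q.+1.*2 =
    \sum_i \int[P]_w ip (Y i w - C) (centered_sum w ^+ q.*2.+1).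
  rewrite /moment; under eq_Rintegral do rewrite split_sum.
  by apply: exp_sum => i; apply: bmeas_ip => //; apply: mbmeasD => //; exact: mbmeasN.
have hterm i : bmeas setT (fun w =>
    ip (centered_sum w ^+ q) ((Y i w + C) *m centered_sum w ^+ q)).
  by apply: bmeas_ip => //; apply: mbmeas_mulmx => //; exact: mbmeasD.
have E2 : moment q.+1.*2 <= \int[P]_w (a * \sum_i
    ip (centered_sum w ^+ q) ((Y i w + C) *m centered_sum w ^+ q)).
  rewrite expZ; last by apply: bmeas_sum.
  by rewrite exp_sum// mulr_sumr E1 aE; apply: ler_sum => i _; exact: exp_term.
have a0 : 0 <= a by rewrite aE mulr_ge0.
(* The weight 1/2 on the higher moment lets it be moved to the left side; this doubles the other
   coefficients to [a^2 + 4 a N lam]. *)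
have E3 : moment q.+1.*2 <= \int[P]_w (2^-1 * \tr (centered_sum w ^+ q.+1.*2) +
    (2^-1 * a ^+ 2 + 2 * a * N%:R * lam) * \tr (centered_sum w ^+ q.*2)).
  apply: le_trans E2 _; apply: exp_le.
  - by apply: bmeasM; [exact: bmeas_cst|exact: bmeas_sum].
  - by apply: bmeasD; apply: bmeasM => //; exact: bmeas_cst.
  move=> w; set Sw := centered_sum w.
  have sS : Sw^T = Sw by exact: centered_sum_sym.
  have -> : \sum_i ip (Sw ^+ q) ((Y i w + C) *m Sw ^+ q) =
      \tr (Sw ^+ q.*2.+1) + 2 * N%:R * ip (Sw ^+ q) (C *m Sw ^+ q).
    rewrite -ip_sumr -mulmx_suml.
    have -> : \sum_i (Y i w + C) = Sw + (2 * N%:R) *: C.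
      rewrite /Sw /centered_sum sumrB big_split /= sumr_const card_ord.
      by rewrite -natrM mulnC scaler_nat mulrnA mulr2n addrA subrK.
    rewrite mulmxDl ipDr -scalemxAl ipZr; congr (_ + _).
    by rewrite -addnn -addSn addnC trX_ip// exprS.
  have Cq : ip (Sw ^+ q) (C *m Sw ^+ q) <= lam * \tr (Sw ^+ q.*2).
    rewrite -addnn trX_ip// ip_cols [ip (Sw ^+ q) (Sw ^+ q)]ip_cols mulr_sumr.
    by apply: ler_sum => j _; rewrite !colE -mulmxA -!colE; exact: C_le.
  have := ler_wpM2l (mulr_ge0 a0 (ler0n R N)) Cq.
  by have := trX_young a q sS; lra.
have : \int[P]_w (2^-1 * \tr (centered_sum w ^+ q.+1.*2) +
    (2^-1 * a ^+ 2 + 2 * a * N%:R * lam) * \tr (centered_sum w ^+ q.*2)) =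
    2^-1 * moment q.+1.*2 + (2^-1 * a ^+ 2 + 2 * a * N%:R * lam) * moment q.*2.
  rewrite expD ?expZ//; by apply: bmeasM => //; exact: bmeas_cst.
move: E3 => /[swap] ->; lra.
Qed.

(** The factor in [moment_step] grows with [q]; since [2q + 1 <= 2p] for [q < p], one value of [a]
    serves all steps. The iteration starts at [tr 1 = m]. *)
Lemma moment_le p a : a = (2 * p)%:R * k ->
  \int[P]_w \tr (centered_sum w ^+ p.*2) <= (a ^+ 2 + 4 * a * N%:R * lam) ^+ p * m%:R.
Proof.
move=> aE; rewrite -/(moment _).
have a0 : 0 <= a by rewrite aE mulr_ge0.
have A0 : 0 <= a ^+ 2 + 4 * a * N%:R * lam by rewrite addr_ge0 ?sqr_ge0// !mulr_ge0.
suff H q : (q <= p)%N -> moment q.*2 <= (a ^+ 2 + 4 * a * N%:R * lam) ^+ q * m%:R.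
  exact: H.
elim: q => [|q IH] qp.
  rewrite /moment; under eq_Rintegral do rewrite expr0 mxtrace1.
  by rewrite exp_cst expr0 mul1r.
apply: le_trans (moment_step (erefl _)) _; rewrite [_ ^+ q.+1]exprS -[leRHS]mulrA.
have mq0 : 0 <= moment q.*2.
  by apply: Rintegral_ge0 => w _; apply: trX_double_ge0; exact: centered_sum_sym.
have aq : q.*2.+1%:R * k <= a.
  by rewrite aE ler_wpM2r// ler_nat mul2n; lia.
have aq0 : 0 <= q.*2.+1%:R * k by rewrite mulr_ge0.
apply: (ler_pM _ mq0 _ (IH (ltnW qp))).
  by rewrite addr_ge0 ?sqr_ge0// !mulr_ge0.
by rewrite lerD// ?ler_sqr ?nnegrE// !ler_wpM2r// ler_wpM2l.
Qed.

Lemma prob_centered_sum p (t a : R) : 0 < t -> a = (2 * p)%:R * k ->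
  fine (P [set w | t ^+ p.*2 < \tr (centered_sum w ^+ p.*2)]) <=
  ((a ^+ 2 + 4 * a * N%:R * lam) / t ^+ 2) ^+ p * m%:R.
Proof.
move=> t0 aE; rewrite expr_div_n mulrAC -exprM mul2n ler_pdivlMr ?exprn_gt0//.
apply: le_trans (moment_le aE); rewrite mulrC; apply: exp_markov => // w.
by apply: trX_double_ge0; exact: centered_sum_sym.
Qed.

End matrix_moments.

(** * Sampling from a density *)

(** The law of [X] is dominated by [mu], and [rho] agrees almost everywhere with its Radon-Nikodym
    derivative because both have the same integral over every measurable set. *)
Lemma exp_density (R : realType) d d' (S : measurableType d) (T : measurableType d')
    (P : probability S R) (mu : {sigma_finite_measure set T -> \bar R})
    (X : S -> T) (rho f : T -> R) :
  measurable_fun setT X -> measurable_fun setT rho -> (forall y, 0 <= rho y) ->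
  (forall B, measurable B -> (P (X @^-1` B) = \int[mu]_(y in B) (rho y)%:E)%E) ->
  bmeas setT f -> \int[P]_w f (X w) = \int[mu]_y (f y * rho y).
Proof.
move=> mX mrho rho0 PX hf.
have bfX : bmeas setT (fun w => f (X w)) by exact: bmeas_comp hf mX _.
pose X' : {mfun S >-> T} := HB.pack X (@isMeasurableFun.Build _ _ _ _ X mX).
pose nu : probability T R := distribution P X'.
have mf : measurable_fun setT (EFin \o f) by apply/measurable_EFinP; exact: hf.1.
have mr : measurable_fun setT (EFin \o rho) by exact/measurable_EFinP.
have nuE B : measurable B -> (nu B = \int[mu]_(y in B) (rho y)%:E)%E by exact: PX.
have numu : nu `<< mu.
  apply/null_content_dominatesP => A mA muA0; rewrite nuE//.
  by rewrite null_set_integral//; exact: measurable_funTS.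
have intf : nu.-integrable setT (EFin \o f) by exact: bmeas_integrable.
have intrho : mu.-integrable setT (EFin \o rho).
  apply/integrableP; split => //.
  under eq_integral do rewrite /= ger0_norm//.
  by rewrite -nuE// (le_lt_trans (probability_le1 nu _))// ltry.
rewrite /Rintegral; congr fine.
transitivity (\int[nu]_y (f y)%:E)%E.
  rewrite /nu /distribution (integral_pushforward _ mf)//.
  exact: (bmeas_integrable P bfX).
rewrite -(Radon_Nikodym_change_of_variables numu)//.
apply: ae_eq_integral => //.
- by apply: emeasurable_funM.
- under eq_fun do rewrite EFinM; exact: emeasurable_funM.
- under [X in ae_eq _ _ _ X]eq_fun do rewrite EFinM.
  apply: ae_eqe_mul2l => /=.
  rewrite Radon_NikodymE//; case: cid => /= h [h1 h2 h3].
  apply: integral_ae_eq => //.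
  by move=> E _ mE; rewrite -h3//; exact: nuE.
Qed.

Section truncated_outer_square.
Context {R : realType} {m : nat} (X : set 'cV[R]_m) (rho : 'cV[R]_m -> R)
  (grad : 'cV[R]_m -> 'cV[R]_m) (L : R).
Hypothesis rho_density : separable_density X rho.
Hypothesis grad_integrable : mx_integrable X rho (outer_sq grad).
Hypothesis grad_le : forall y, X y -> vnorm (grad y) <= L.

(* Nothing is known about [grad] outside [X], not even measurability. *)
Definition trunc_outer (y : 'cV[R]_m) : 'M[R]_m :=
  if `[< X y >] then outer_sq grad y else 0.

Lemma density_ge0 y : 0 <= rho y.
Proof.
have [Xy|nXy] := pselect (X y); first by rewrite ltW// (density_gt0 rho_density).
by rewrite (density_eq0 rho_density).
Qed.

Lemma measurable_density_support : measurable X.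
Proof.
have -> : X = setT `&` rho @^-1` `]0, +oo[.
  apply/seteqP; split => y /=; rewrite in_itv/= andbT.
    by move=> Xy; split => //; exact: (density_gt0 rho_density).
  by move=> [_ r0]; apply: contrapT => /(density_eq0 rho_density) r; rewrite r ltxx in r0.
by apply: (density_measurable rho_density) => //; exact: measurable_itv.
Qed.

(** Integrability yields measurability on [X] only for the product with [rho]; as [rho] is positive
    on [X], dividing by it recovers the entries. *)
Lemma measurable_trunc_outer : measurable_fun setT trunc_outer.
Proof.
have mX := measurable_density_support.
apply: measurable_fun_mxP => i j.
have -> : (fun y => trunc_outer y i j) =
    ((fun y => outer_sq grad y i j * rho y) \_ X) \* (fun y => rho y `^ (-1)).
  apply/funext => y; rewrite /= patchE /trunc_outer; have [Xy|nXy] := pselect (X y).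
    have r0 := density_gt0 rho_density Xy.
    by rewrite mem_set// asboolT// powR_inv1 ?ltW// mulfK// gt_eqF.
  by rewrite memNset// asboolF// mul0r mxE.
apply: measurable_funM.
  apply/(measurable_restrictT _ mX); apply/measurable_EFinP.
  exact: measurable_int (grad_integrable i j).
exact: measurableT_comp (measurable_powR _) (density_measurable rho_density).
Qed.

Lemma trunc_outer_sym y : (trunc_outer y)^T = trunc_outer y.
Proof.
by rewrite /trunc_outer; case: ifP => _; rewrite ?trmx0// /outer_sq trmx_mul trmxK.
Qed.

Lemma ip_outer_sq y (v : 'cV[R]_m) :
  ip v (outer_sq grad y *m v) = ip (grad y) v ^+ 2.
Proof.
rewrite /outer_sq -mulmxA ipC ipMl.
have -> : (grad y)^T *m v = (ip (grad y) v)%:M.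
  by rewrite [LHS]mx11_scalar /ip /mxtrace big_ord1.
by rewrite /ip tr_scalar_mx -scalar_mxM mxtrace_scalar expr2.
Qed.

Lemma trunc_outer_psd y : psd (trunc_outer y).
Proof.
move=> v; rewrite /trunc_outer; case: ifP => _; last by rewrite mul0mx ipC ip0l.
by rewrite ip_outer_sq sqr_ge0.
Qed.

(** For a rank one matrix, [(g g^T)^2 = |g|^2 g g^T]. *)
Lemma trunc_outer_sqr y : psd (L ^+ 2 *: trunc_outer y - trunc_outer y *m trunc_outer y).
Proof.
move=> v; rewrite /trunc_outer; case: asboolP => Xy; last first.
  by rewrite mul0mx scaler0 subr0 mul0mx ipC ip0l.
have gL := grad_le Xy; rewrite vnormE in gL.
have -> : outer_sq grad y *m outer_sq grad y = ip (grad y) (grad y) *: outer_sq grad y.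
  rewrite /outer_sq -mulmxA [_^T *m (_ *m _)]mulmxA.
  have -> : (grad y)^T *m grad y = (ip (grad y) (grad y))%:M.
    by rewrite [LHS]mx11_scalar /ip /mxtrace big_ord1.
  by rewrite mul_scalar_mx -scalemxAr.
rewrite -scalerBl -scalemxAl ipZr ip_outer_sq mulr_ge0 ?sqr_ge0// subr_ge0.
by rewrite -sqr_fnorm ler_sqr ?nnegrE ?fnorm_ge0// (le_trans _ gL) ?fnorm_ge0.
Qed.

Lemma trunc_outer_bound y a b : `|trunc_outer y a b| <= L ^+ 2.
Proof.
rewrite /trunc_outer; case: asboolP => Xy; last by rewrite mxE normr0 sqr_ge0.
have gL := grad_le Xy; rewrite vnormE in gL.
have entry i : `|grad y i 0| <= L.
  apply: le_trans gL; rewrite -ler_sqr ?nnegrE ?fnorm_ge0// sqr_fnorm ip_col.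
  rewrite real_normK ?num_real// (bigD1 i)//= -expr2 lerDl sumr_ge0// => j _.
  by rewrite -expr2 sqr_ge0.
by rewrite /outer_sq mxE big_ord1 mxE normrM expr2 ler_pM.
Qed.

Lemma trunc_outer_mean d (Omega : measurableType d) (P : probability Omega R)
    (x : Omega -> 'cV[R]_m) i j : measurable_fun setT x ->
  (forall B, measurable B -> (P (x @^-1` B) = \int[lebesgue_vec m]_(y in B) (rho y)%:E)%E) ->
  \int[P]_w trunc_outer (x w) i j = mx_integral X rho (outer_sq grad) i j.
Proof.
move=> mx Px; rewrite (exp_density (f := fun y => trunc_outer y i j) mx (density_measurable rho_density) density_ge0 Px); last first.
  split; last by exists (L ^+ 2) => y _; exact: trunc_outer_bound.
  exact: measurableT_comp (measurable_mx_coord i j) measurable_trunc_outer.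
rewrite mxE [RHS]Rintegral_mkcond; apply: eq_Rintegral => y _.
rewrite patchE /trunc_outer; have [Xy|nXy] := pselect (X y).
  by rewrite mem_set// asboolT.
by rewrite memNset// asboolF// mxE mul0r.
Qed.

End truncated_outer_square.

(* The exponent [p] is of order [ln m], so that the loss [m] in passing from the
   spectral norm to the trace is compensated by [e^-p]. *)
Lemma moment_tail (R : realType) (beta : R) : 0 < beta ->
  exists2 c : R, 0 < c & forall (m N : nat) (k lam eps : R), (1 < m)%N ->
    0 < k -> 0 < lam -> 0 < eps -> eps <= 1 ->
    c * (k / (lam * eps ^+ 2)) * ln m%:R <= N%:R ->
    exists2 p : nat, (0 < p)%N &
      ((((2 * p)%:R * k) ^+ 2 + 4 * ((2 * p)%:R * k) * N%:R * lam) /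
        (N%:R * (lam * eps)) ^+ 2) ^+ p * m%:R <= m%:R `^ (- beta).
Proof.
move=> beta0; have l2 : 0 < ln (2 : R) by rewrite ln_gt0// ltr1n.
(* The last summand pays for rounding up to an integer, since [ln m >= ln 2]. *)
pose B : R := 1 + beta + (ln 2)^-1.
have B0 : 0 < B by rewrite addr_gt0 ?invr_gt0// addr_gt0.
have e0 : 0 < expR (1 : R) by exact: expR_gt0.
exists (10 * B * expR 1); first by rewrite !mulr_gt0.
move=> m N k lam eps m1 k0 lam0 eps0 eps1 hN.
have m0 : 0 < m%:R :> R by rewrite ltr0n; lia.
have lm : ln (2 : R) <= ln m%:R by rewrite ler_ln ?posrE// ler_nat.
have lm0 : 0 < ln (m%:R : R) by exact: lt_le_trans lm.
have N0 : 0 < N%:R :> R.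
  by apply: lt_le_trans hN; rewrite !mulr_gt0// invr_gt0 mulr_gt0// exprn_gt0.
set z := (1 + beta) * ln (m%:R : R); exists (Num.truncn z).+1 => //.
set p := (Num.truncn z).+1.
have z0 : 0 <= z by rewrite mulr_ge0 ?ltW// addr_gt0.
have zp : z <= p%:R by rewrite ltW// truncnS_gt.
have pB : p%:R <= B * ln (m%:R : R).
  have : (Num.truncn z)%:R <= z by rewrite truncn_le.
  rewrite /p -addn1 natrD /B mulrDl -/z => h; apply: lerD => //.
  by rewrite mulrC ler_pdivlMr// mul1r.
set a := (2 * p)%:R * k; set t := N%:R * (lam * eps).
have t0 : 0 < t by rewrite !mulr_gt0.
have a0 : 0 <= a by rewrite mulr_ge0// ltW.
(* The terms [a^2] and [4 a N lam] will be at most [u t^2] and [4 u t^2], so the ratio is at most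
   [5 u = e^-1]. With [a <= 2 B k ln m] this asks for the constant [10 B e]. *)
pose u : R := (5 * expR 1)^-1.
have u0 : 0 < u by rewrite invr_gt0 mulr_gt0.
have aN : a <= u * (N%:R * lam * eps ^+ 2).
  rewrite /u mulrC ler_pdivlMr ?mulr_gt0//.
  have : 10 * B * expR 1 * k * ln (m%:R : R) <= N%:R * (lam * eps ^+ 2).
    rewrite -ler_pdivrMr ?mulr_gt0 ?exprn_gt0//; apply: le_trans hN.
    by rewrite le_eqVlt; apply/orP; left; apply/eqP; ring.
  rewrite -[N%:R * lam * _]mulrA; apply: le_trans.
  rewrite /a natrM -!mulrA.
  have -> : 10 * (B * (expR 1 * (k * ln (m%:R : R)))) = 2 * (B * ln m%:R * (k * (5 * expR 1))) by ring.
  by rewrite ler_pM2l// ler_pM2r// !mulr_gt0.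
have rle : (a ^+ 2 + 4 * a * N%:R * lam) / t ^+ 2 <= expR (- 1).
  rewrite ler_pdivrMr ?exprn_gt0//.
  have u1 : u <= 1.
    rewrite invf_le1 ?mulr_gt0//; have := @expR_ge1Dx R 1; lra.
  have -> : expR (- 1) = 5 * u by rewrite /u expRN invfM mulrA divff ?mul1r.
  have w0 : 0 <= N%:R * lam * eps ^+ 2 by rewrite !mulr_ge0 ?ltW// exprn_gt0.
  have h1 : a ^+ 2 <= u * t ^+ 2.
    apply: (@le_trans _ _ ((u * (N%:R * lam * eps ^+ 2)) ^+ 2)).
      by rewrite ler_sqr ?nnegrE// mulr_ge0// ltW.
    have -> : (u * (N%:R * lam * eps ^+ 2)) ^+ 2 = (u * t ^+ 2) * (u * eps ^+ 2) by rewrite /t; ring.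
    have ue1 : u * eps ^+ 2 <= 1 by rewrite mulr_ile1 ?(ltW u0) ?sqr_ge0// expr_le1// ltW.
    by rewrite ler_piMr// mulr_ge0 ?(ltW u0)// sqr_ge0.
  have h2 : 4 * a * N%:R * lam <= 4 * (u * t ^+ 2).
    have -> : 4 * (u * t ^+ 2) = 4 * (u * (N%:R * lam * eps ^+ 2)) * N%:R * lam by rewrite /t; ring.
    by rewrite !ler_pM2r// ler_pM2l.
  rewrite -[leRHS]mulrA; move: h1 h2.
  by move: (a ^+ 2) (4 * a * N%:R * lam) (u * t ^+ 2) => A1 A2 A3; lra.
have r0 : 0 <= (a ^+ 2 + 4 * a * N%:R * lam) / t ^+ 2.
  by rewrite divr_ge0 ?sqr_ge0// addr_ge0 ?sqr_ge0// !mulr_ge0// ltW.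
apply: (@le_trans _ _ (expR (- 1) ^+ p * m%:R)).
  by rewrite ler_pM2r// lerXn2r ?nnegrE ?expR_ge0.
rewrite -expRM_natl mulrN1 /powR gt_eqF// -{1}[m%:R]lnK ?posrE// -expRD ler_expR.
by move: zp; rewrite /z; lra.
Qed.

(** * Concentration of the sample mean *)

Section sample_mean.
Context {R : realType} {m : nat}.

Lemma sample_mean_psd N (g : 'cV[R]_m -> 'cV[R]_m) (x : 'I_N -> 'cV[R]_m) :
  psd (sample_mean_outer g x).
Proof.
move=> v; rewrite /sample_mean_outer -scalemxAl ipZr mulr_ge0 ?invr_ge0//.
rewrite mulmx_suml ip_sumr sumr_ge0// => j _.
by rewrite ip_outer_sq sqr_ge0.
Qed.

Lemma sample_mean_diff N (g grad : 'cV[R]_m -> 'cV[R]_m) (x : 'I_N -> 'cV[R]_m)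
    (e L : R) : (0 < N)%N ->
  (forall j, vnorm (g (x j) - grad (x j)) <= e) -> (forall j, vnorm (grad (x j)) <= L) ->
  opbound (sample_mean_outer g x - sample_mean_outer grad x) (e * (e + 2 * L)).
Proof.
move=> N0 he hL; rewrite /sample_mean_outer -scalerBr -sumrB.
have cst (s : R) : s = `|N%:R^-1| * \sum_(j < N) s.
  rewrite sumr_const card_ord ger0_norm ?invr_ge0// -[s *+ N]mulr_natl mulKf//.
  by rewrite pnatr_eq0 -lt0n.
rewrite (cst (e * _)).
apply: opboundZ; apply: opbound_sum => j; apply: opbound_outer_diff.
  by have := he j; rewrite vnormE.
by have := hL j; rewrite vnormE.
Qed.

(** Both errors are at most a fifth of the gap [l - l'], so at least three fifths remain in the
    denominator and the factor 5/3 is within 4. In the term with [s] the gap is then replaced by the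
    smaller [(1 - e) l - (1 + e) l']. *)
Lemma davis_kahan_bound_le (e a s l l' : R) : 0 <= a -> 0 <= s -> 0 < e -> 0 < l' ->
  s <= ((1 - e) * l - (1 + e) * l') / 5 -> 5 * a < l - l' ->
  0 < (1 - e) * l - (1 + e) * l' ->
  (s + a) / (l - l' - (s + a)) <=
    4 * s / ((1 - e) * l - (1 + e) * l') + 4 * a / (l - l').
Proof.
set g := (1 - e) * l - _ => a0 s0 e0 l0 sg al g0.
have gl : g <= l - l'.
  have : 0 <= e * (l + l') by rewrite mulr_ge0 ?ltW//; lra.
  rewrite /g; lra.
have d0 : 0 < l - l' by lra.
have sl : s <= (l - l') / 5 by apply: le_trans sg _; rewrite ler_pM2r ?invr_gt0.
apply: (@le_trans _ _ (4 * (s + a) / (l - l'))).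
  rewrite ler_pdivrMr; last by lra.
  rewrite mulrAC ler_pdivlMr// -subr_ge0.
  rewrite (_ : _ - _ = (s + a) * (3 * (l - l') - 4 * (s + a))); last by ring.
  by apply: mulr_ge0; [exact: addr_ge0|lra].
rewrite mulrDr mulrDl lerD2r -!mulrA !ler_wpM2l//.
by rewrite lef_pV2 ?posrE.
Qed.

End sample_mean.

Section concentration.
Context {R : realType} {d} {Omega : measurableType d} (P : probability Omega R).
Context {m N : nat} (X : set 'cV[R]_m) (rho : 'cV[R]_m -> R)
  (grad : 'cV[R]_m -> 'cV[R]_m) (L : R) (x : 'I_N -> Omega -> 'cV[R]_m)
  (W : 'M[R]_m) (lam : nat -> R).
Local Notation C := (mx_integral X rho (outer_sq grad)).
Hypothesis rho_density : separable_density X rho.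
Hypothesis grad_integrable : mx_integrable X rho (outer_sq grad).
Hypothesis grad_le : forall y, X y -> vnorm (grad y) <= L.
Hypothesis x_iid : iid_sample P rho x.
Hypothesis C_eig : eigen_decomposition C W lam.
Hypothesis m_gt0 : (0 < m)%N.

Lemma prob_sample_support j : P (x j @^-1` X) = 1%E.
Proof.
have mX := measurable_density_support rho_density.
rewrite (sample_density x_iid)// -(density_integral1 rho_density).
rewrite [LHS]integral_mkcond; apply: eq_integral => y _; rewrite patchE.
by have [Xy|nXy] := pselect (X y); [rewrite mem_set|rewrite memNset// (density_eq0 rho_density)].
Qed.

(** If [L = 0], then [C = 0] and its leading eigenvalue vanishes. The strict positivity of [L^2] is
    required by [moment_tail] and forces [N > 0]. *)
Lemma gradient_bound_neq0 : 0 < lam 1 -> L != 0.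
Proof.
move=> l1; apply: contra_ltN l1 => /eqP L0.
have C0 : C = 0.
  apply/matrixP => i j; rewrite !mxE.
  transitivity (\int[lebesgue_vec m]_(y in X) (0 : R)); last first.
    by rewrite /Rintegral integral0.
  apply: eq_Rintegral => y /set_mem Xy.
  have := grad_le Xy; rewrite vnormE L0 => g0.
  have /eqP : fnorm (grad y) = 0 by apply/eqP; rewrite eq_le g0 fnorm_ge0.
  by rewrite fnorm_eq0 => /eqP gy; rewrite /outer_sq gy mul0mx mxE mul0r.
have [WW _ _] := C_eig.
have := ip_spec_fun_col WW (fun i => lam i.+1) (Ordinal m_gt0).
by rewrite -(eigen_decompositionE C_eig) C0 mul0mx ipC ip0l /= => <-.
Qed.

(** An observation, available as [N > 0], turns the entrywise integrals into the expectation of one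
    positive semidefinite matrix. *)
Lemma mean_psd : (0 < N)%N -> psd C.
Proof.
move=> N0 v; pose j := Ordinal N0.
have mY : mbmeas setT (fun w => trunc_outer X grad (x j w)).
  move=> a b; split.
    exact: measurableT_comp (measurable_mx_coord a b) (measurableT_comp
      (measurable_trunc_outer rho_density grad_integrable) (sample_measurable x_iid j)).
  by exists (L ^+ 2) => w _; exact: trunc_outer_bound.
rewrite (_ : ip v _ = \int[P]_w ip v (trunc_outer X grad (x j w) *m v)).
  by apply: Rintegral_ge0 => w _; exact: trunc_outer_psd.
have ipv (M : 'M[R]_m) : ip v (M *m v) = \sum_a \sum_b (v a 0 * v b 0) * M a b.
  rewrite ip_col; apply: eq_bigr => a _; rewrite mxE mulr_sumr.
  by apply: eq_bigr => b _; ring.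
under eq_Rintegral do rewrite ipv.
have bt a b : bmeas setT (fun w => v a 0 * v b 0 * trunc_outer X grad (x j w) a b).
  by apply: bmeasM; [exact: bmeas_cst|exact: mY].
rewrite ipv exp_sum => [|a]; last exact: bmeas_sum.
apply: eq_bigr => a _; rewrite exp_sum//; apply: eq_bigr => b _.
rewrite expZ; last exact: mY.
by rewrite (trunc_outer_mean rho_density grad_integrable grad_le _ _ (sample_measurable x_iid j) (sample_density x_iid j)).
Qed.

Lemma sample_mean_concentration (p : nat) (e a q : R) :
  (0 < p)%N -> (0 < N)%N -> 0 <= lam 1 -> 0 < e -> a = (2 * p)%:R * L ^+ 2 ->
  ((a ^+ 2 + 4 * a * N%:R * lam 1) / (N%:R * e) ^+ 2) ^+ p * m%:R <= q ->
  with_probability_at_least P (1 - q) (fun w => (forall j, X (x j w)) /\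
    opbound (sample_mean_outer grad (fun j => x j w) - C) e).
Proof.
move=> p0 N0 l0 e0 aE hq; have [WW _ lam_le] := C_eig.
have NR : 0 < N%:R :> R by rewrite ltr0n.
pose Y j w := trunc_outer X grad (x j w).
have mY j : measurable_fun setT (Y j).
  exact: measurableT_comp (measurable_trunc_outer rho_density grad_integrable)
    (sample_measurable x_iid j).
have Y_indep (B : 'I_N -> set 'M[R]_m) : (forall j, measurable (B j)) ->
    P (\bigcap_j (Y j @^-1` B j)) = (\prod_j P (Y j @^-1` B j))%E.
  move=> mB; have h j : measurable (trunc_outer X grad @^-1` B j).
    rewrite -[X in measurable X]setTI.
    exact: (measurable_trunc_outer rho_density grad_integrable).
  have := sample_independent x_iid [set: 'I_N]%SET h.
  rewrite (_ : [set` _] = setT); last first.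
    by apply/seteqP; split => // j _; rewrite /= inE.
  by move=> ->; apply: eq_bigl => j; rewrite inE.
have C_sym : C^T = C by rewrite (eigen_decompositionE C_eig) spec_fun_tr.
have C_le (v : 'cV[R]_m) : ip v (C *m v) <= lam 1 * ip v v.
  rewrite {1}(eigen_decompositionE C_eig) ip_spec_fun// -sqr_fnorm (sqr_fnorm_orth WW).
  rewrite mulr_sumr; apply: ler_sum => i _; rewrite ler_wpM2r ?sqr_ge0//.
  by apply: lam_le.
have Y_mean j a' b : \int[P]_w Y j w a' b = C a' b.
  exact: (trunc_outer_mean rho_density grad_integrable grad_le _ _
    (sample_measurable x_iid j) (sample_density x_iid j)).
have Y_sym j w : (Y j w)^T = Y j w by exact: trunc_outer_sym.
have Y_sqr j w : psd (L ^+ 2 *: Y j w - Y j w *m Y j w) by exact: trunc_outer_sqr.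
have Y_bound j w a' b : `|Y j w a' b| <= L ^+ 2 by exact: trunc_outer_bound.
have t0 : 0 < N%:R * e by rewrite mulr_gt0.
(* Outside this event [opbound_trX] bounds the sum by [N e], hence the mean by [e]. *)
pose bad := [set w | (N%:R * e) ^+ p.*2 < \tr (centered_sum Y C w ^+ p.*2)].
have bad_le : fine (P bad) <= q.
  apply: le_trans hq.
  exact: (prob_centered_sum mY Y_indep Y_sym Y_sqr Y_bound Y_mean C_sym C_le
    (sqr_ge0 L) l0 t0 aE).
have mbad : measurable bad.
  have [mtr _] := bmeas_tr (mbmeasX p.*2 (mbmeas_centered_sum C mY Y_bound)).
  rewrite -[X in measurable X]setTI [X in measurable X](_ : _ =
    setT `&` (fun w => \tr (centered_sum Y C w ^+ p.*2)) @^-1` `](N%:R * e) ^+ p.*2, +oo[).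
    by apply: mtr => //; exact: measurable_itv.
  by apply/seteqP; split => w /=; rewrite in_itv/= andbT.
pose supp := \bigcap_j (x j @^-1` X).
have mX := measurable_density_support rho_density.
have mpre j : measurable (x j @^-1` X).
  by rewrite -[X in measurable X]setTI; exact: (sample_measurable x_iid j).
have msupp : measurable supp by apply: fin_bigcap_measurable => // j _.
have Psupp : P supp = 1%E.
  have := sample_independent x_iid [set: 'I_N]%SET (fun=> mX).
  rewrite (_ : [set` _] = setT); last first.
    by apply/seteqP; split => // j _; rewrite /= inE.
  move=> ->; apply: big1 => j _; exact: prob_sample_support.
exists (supp `&` ~` bad); split.
- by apply: measurableI => //; exact: measurableC.
- have Pbad : P bad = (fine (P bad))%:E by rewrite fineK// fin_num_measure.
  have : (P supp <= P (supp `&` ~` bad) + P bad)%E.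
    apply: le_trans (measureU2 _ _ _) => //; last first.
      by apply: measurableI => //; exact: measurableC.
    apply: le_measure; rewrite ?inE//.
      by apply: measurableU => //; apply: measurableI => //; exact: measurableC.
    by move=> w sw; have [bw|nbw] := pselect (bad w); [right|left].
  rewrite Psupp Pbad -leeBlDr// => h; apply: le_trans h.
  by rewrite -EFinB lee_fin lerB.
move=> w [sw nbw]; have Xw j : X (x j w) by exact: sw.
split=> //; move/negP: nbw; rewrite /bad /= -leNgt => tr_le.
have S_sym := centered_sum_sym Y_sym C_sym w.
have := opboundZ N%:R^-1 (opbound_trX S_sym (ltW t0) p0 tr_le).
rewrite ger0_norm ?invr_ge0// mulrA mulVf ?gt_eqF// mul1r.
rewrite (_ : _ *: _ = sample_mean_outer grad (fun j => x j w) - C)//.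
rewrite /centered_sum sumrB scalerBr /sample_mean_outer; congr (_ - _).
  by congr (_ *: _); apply: eq_bigr => j _; rewrite /Y /trunc_outer asboolT.
by rewrite sumr_const card_ord -[X in _ *: X = _]scaler_nat scalerA mulVf ?gt_eqF// scale1r.
Qed.

End concentration.

(** * The eigenspace bound for approximate gradients *)

Unset Implicit Arguments.

Theorem theorem3p10 (R : realType) (beta : R) (beta_gt0 : 0 < beta) :
  exists2 c : R, 0 < c &
  forall (m : nat) (X : set 'cV[R]_m) (rho f : 'cV[R]_m -> R)
    (grad : 'cV[R]_m -> 'cV[R]_m)
    (g : R -> 'cV[R]_m -> 'cV[R]_m) (gamma : R -> R)
    (L : R) (W : 'M[R]_m) (lam : nat -> R)
    (n : nat) (n_gt0 : (0 < n)%N) (n_lt_m : (n < m)%N)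
    (eps h : R) (N : nat)
    (d : measure_display) (Omega : measurableType d)
    (P : probability Omega R) (x : 'I_N -> Omega -> 'cV[R]_m),
  let C := mx_integral X rho (outer_sq grad) in
  let nu2 := specnorm (mx_integral X rho
    (fun y => (outer_sq grad y - C) *m (outer_sq grad y - C))) in
  let delta := Num.max (nu2 / (lam 1%N * eps)) (L ^+ 2) in
  let kappa := lam 1%N / lam n.+1 in
  let err := Num.sqrt m%:R * gamma h * (Num.sqrt m%:R * gamma h + 2 * L) in
  let gap_eps := (1 - eps) * lam n - (1 + eps) * lam n.+1 in
  (1 < m)%N ->
  centered_scaled X ->
  separable_density X rho ->
  (forall y, X y -> is_gradient X f y (grad y)) ->
  abs_continuous_on X f ->
  mx_integrable X rho (outer_sq grad) ->
  eigen_decomposition C W lam ->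
  (forall t, 0 < t -> 0 <= gamma t) ->
  gamma t @[t --> 0^'+] --> (0 : R) ->
  (forall y, X y -> vnorm (grad y) <= L) ->
  0 < nu2 ->
  (forall t y, 0 < t -> X y ->
    vnorm (g t y - grad y) <= Num.sqrt m%:R * gamma t) ->
  0 < lam n.+1 ->
  0 < eps ->
  eps < Num.min 1 (Num.min ((lam n - lam n.+1) / (5 * lam 1%N))
                           ((lam n - lam n.+1) / (lam n + lam n.+1))) ->
  iid_sample P rho x ->
  c * (delta / (lam 1%N * eps)) * ln (2 * m)%:R <= N%:R ->
  c * (L ^+ 2 * kappa ^+ 2 / (lam 1%N * eps ^+ 2)) * ln m%:R <= N%:R ->
  0 < h ->
  err <= gap_eps / 5 ->
  with_probability_at_least P (1 - m%:R `^ (- beta)) (fun w =>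
    forall (U : 'M[R]_m) (theta : nat -> R),
      eigen_decomposition (sample_mean_outer (g h) (fun j => x j w)) U theta ->
      range_dist (first_cols (ltnW n_lt_m) U) (first_cols (ltnW n_lt_m) W)
        <= 4 * err / gap_eps + 4 * lam 1%N * eps / (lam n - lam n.+1)).
Proof.
have [c c0 tail] := moment_tail beta_gt0.
exists c => // m X rho f grad g gamma L W lam n n_gt0 n_lt_m eps h N d Omega P x.
move=> C nu2 delta kappa err gap_eps m1 _ rhoD _ _ intgrad dC gamma0 _ gradL _.
move=> gradg lamn1 eps0; rewrite !lt_min => /and3P[eps1 eps_lam1 eps_gap].
move=> iid _ hN h0 err_le.
have [WW _ lam_le] := dC.
have lam_n : lam n.+1 <= lam n by apply: lam_le.
have lam_1 : lam n.+1 <= lam 1%N by apply: lam_le.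
have lam1 : 0 < lam 1%N by exact: lt_le_trans lam_1.
have Lneq0 := gradient_bound_neq0 gradL dC (ltnW m1) lam1.
have L2 : 0 < L ^+ 2 by rewrite lt_def sqr_ge0 sqrf_eq0 Lneq0.
have lnm0 : 0 < ln (m%:R : R) by rewrite ln_gt0// ltr1n.
have lnm := ltW lnm0.
have hN' : c * (L ^+ 2 / (lam 1%N * eps ^+ 2)) * ln m%:R <= N%:R.
  apply: le_trans hN; rewrite ler_wpM2r// ler_pM2l// ler_pM2r ?invr_gt0 ?mulr_gt0 ?exprn_gt0//.
  rewrite ler_pMr// exprn_ege1// /kappa ler_pdivlMr// mul1r//.
have N0 : (0 < N)%N.
  rewrite -(ltr0n R); apply: lt_le_trans hN'.
  by rewrite mulr_gt0// mulr_gt0// divr_gt0// mulr_gt0// exprn_gt0.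
have [p p0 hp] := tail m N (L ^+ 2) (lam 1%N) eps m1 L2 lam1 eps0 (ltW eps1) hN'.
have lame0 : 0 < lam 1%N * eps by rewrite mulr_gt0.
have [E [mE PE Ew]] := sample_mean_concentration rhoD intgrad gradL iid dC
  p0 N0 (ltW lam1) lame0 erefl hp.
(* [E] is fixed before [U] and [theta], so one event serves all eigendecompositions of the
   approximate sample mean. *)
exists E; split => // w /Ew[Xw hC] U theta dG.
have L0 : 0 <= L by apply: le_trans (gradL _ (Xw (Ordinal N0))); rewrite vnormE fnorm_ge0.
have sg0 : 0 <= Num.sqrt m%:R * gamma h by rewrite mulr_ge0 ?sqrtr_ge0 ?gamma0.
have err0 : 0 <= err by rewrite mulr_ge0// addr_ge0// mulr_ge0.
have hG : opbound (sample_mean_outer (g h) (fun j => x j w) -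
    sample_mean_outer grad (fun j => x j w)) err.
  by apply: sample_mean_diff => // j; [exact: gradg|exact: gradL].
have hE := opboundD hG hC; rewrite addrA subrK in hE.
have sum0 : 0 < lam n + lam n.+1 by rewrite addr_gt0// (lt_le_trans lamn1).
(* This is the third bound on [eps], cleared of its denominator; the second one gives [a5]. *)
have gap0 : 0 < gap_eps.
  by move: eps_gap; rewrite ltr_pdivlMr// /gap_eps; lra.
have a5 : 5 * (lam 1%N * eps) < lam n - lam n.+1.
  by move: eps_lam1; rewrite ltr_pdivlMr ?mulr_gt0//; lra.
have geps : gap_eps <= lam n - lam n.+1.
  have : 0 <= eps * (lam n + lam n.+1) by rewrite mulr_ge0 ?ltW.
  by rewrite /gap_eps; lra.
apply: le_trans (davis_kahan n_lt_m n_gt0 dC dG _ _ _ hE _) _.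
- exact: mean_psd rhoD intgrad gradL iid N0.
- exact: sample_mean_psd.
- by rewrite addr_ge0// ltW.
- by lra.
rewrite -[4 * lam 1%N * eps]mulrA.
by apply: davis_kahan_bound_le => //; exact: ltW.
Qed.
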